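(* Let $\Bbbk$ be a field, let $\alpha\in\Bbbk^\times$, and let $B=B_K(\alpha)$ be the connected graded $\Bbbk$-algebra generated by the degree-one elements $x_1,x_2,y_1,y_2$ subject to the relations $$x_2x_1=-x_1x_2,\quad y_2y_1=-y_1y_2,\quad y_1x_1=x_1y_1,\quad y_1x_2=x_2y_2,\quad y_2x_1=x_1y_2,\quad y_2x_2=\alpha x_2y_1.$$ Then the sequence of graded right $B$-modules $$0\longrightarrow B(-4)\xrightarrow{d_4}B(-3)^4\xrightarrow{d_3}B(-2)^6\xrightarrow{d_2}B(-1)^4\xrightarrow{d_1}B\longrightarrow k_B\longrightarrow 0,$$ where $B\to k_B$ is the canonical augmentation and $$d_1=\begin{pmatrix}x_1&x_2&y_1&y_2\end{pmatrix},\qquad d_2=\begin{pmatrix} x_2&0&-y_1&0&-y_2&0\\ x_1&0&0&-y_2&0&-\alpha y_1\\ 0&y_2&x_1&x_2&0&0\\ 0&y_1&0&0&x_1&x_2 \end{pmatrix},$$ $$d_3=\begin{pmatrix} y_2&\alpha y_1&0&0\\ 0&0&x_1&x_2\\ x_2&0&-y_2&0\\ x_1&0&0&-\alpha y_1\\ 0&x_2&-y_1&0\\ 0&x_1&0&-y_2 \end{pmatrix},\qquad d_4=\begin{pmatrix}\alpha y_1\\ y_2\\ x_2\\ x_1\end{pmatrix},$$ is the minimal graded free resolution of the trivial right module $k_B$. In particular, $$\beta_{0,0}^B(k_B)=1,\quad \beta_{1,1}^B(k_B)=4,\quad \beta_{2,2}^B(k_B)=6,\quad \beta_{3,3}^B(k_B)=4,\quad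 \beta_{4,4}^B(k_B)=1.$$
   Context: All modules are finitely generated graded right $B$-modules. $B=\bigoplus_{n\ge0}B_n$ is graded with $x_1,x_2,y_1,y_2$ in degree $1$; $B_{\ge1}=\bigoplus_{n\ge1}B_n$; $k_B=B/B_{\ge1}$ is the trivial right module, and the augmentation is the canonical map $B\to\Bbbk$. $B(-j)$ is the free right module of rank one with degrees shifted so that its generator is in degree $j$. Elements of free right modules $B(-j)^n$ are written as column vectors, and a matrix with entries in $B$ acts by left multiplication on columns (hence is right $B$-linear). A graded free resolution of $M$ is an exact complex $\cdots\to F_1\xrightarrow{d_1}F_0\to M\to0$ of graded right modules with degree-preserving maps and each $F_i$ graded free; it is minimal if $d_i(F_i)\subseteq F_{i-1}B_{\ge1}$ for all $i\ge1$. The graded Betti numbers are $\beta_{i,j}^B(M)=\dim_\Bbbk\operatorname{Tor}_i^B(M,\Bbbk)_j$; equivalently, in the minimal graded free resolution $F_i\cong\bigoplus_j B(-j)^{\beta_{i,j}^B(M)}$. *)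

(* Defs.v *)
From HB Require Import structures.
From mathcomp Require Import all_boot all_order all_algebra.
From mathcomp Require Import finmap boolp.
From mathcomp.multinomials Require Import monalg.

Set Implicit Arguments.
Unset Strict Implicit.
Unset Printing Implicit Defensive.

Import GRing.Theory.
Local Open Scope ring_scope.
Local Open Scope quotient_scope.

Section TwoSidedIdeal.
Variables (R : nzRingType) (S : seq R).

Definition two_sided_ideal (f : R) : Prop :=
  exists2 s : seq (R * R * R),
    all (fun t => t.1.2 \in S) s & f = \sum_(t <- s) t.1.1 * t.1.2 * t.2.

Definition two_sided_ideal_pred : {pred R} := fun f => `[< two_sided_ideal f >].

Lemma two_sided_idealP f :
  reflect (two_sided_ideal f) (f \in two_sided_ideal_pred).
Proof. exact: asboolP. Qed.

Lemma two_sided_ideal_zmod_closed : zmod_closed two_sided_ideal_pred.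
Proof.
split=> [|f g /two_sided_idealP[s Ss ->] /two_sided_idealP[t St ->]];
  apply/two_sided_idealP.
  by exists [::]; rewrite ?big_nil.
exists (s ++ [seq (- u.1.1, u.1.2, u.2) | u <- t]).
  by rewrite all_cat Ss all_map.
rewrite big_cat big_map -sumrN; congr (_ + _).
by apply: eq_bigr => u _; rewrite !mulNr.
Qed.

HB.instance Definition _ :=
  GRing.isZmodClosed.Build R two_sided_ideal_pred two_sided_ideal_zmod_closed.

Lemma two_sided_idealMl g f :
  f \in two_sided_ideal_pred -> g * f \in two_sided_ideal_pred.
Proof.
move=> /two_sided_idealP[s Ss ->]; apply/two_sided_idealP.
exists [seq (g * u.1.1, u.1.2, u.2) | u <- s]; first by rewrite all_map.
by rewrite big_map mulr_sumr; apply: eq_bigr => u _; rewrite !mulrA.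
Qed.

Lemma two_sided_idealMr g f :
  f \in two_sided_ideal_pred -> f * g \in two_sided_ideal_pred.
Proof.
move=> /two_sided_idealP[s Ss ->]; apply/two_sided_idealP.
exists [seq (u.1.1, u.1.2, u.2 * g) | u <- s]; first by rewrite all_map.
by rewrite big_map mulr_suml; apply: eq_bigr => u _; rewrite !mulrA.
Qed.

End TwoSidedIdeal.

(* The free algebra on four letters, as the monoid algebra of the free monoid;
   the letters 0, 1, 2, 3 stand for x1, x2, y1, y2. *)
Notation freealg k := {malg k[{fmonom 'I_4}]}.

Definition letter (k : fieldType) (i : nat) : freealg k := << fmu (inord i) >>.

Definition BK_relators (k : fieldType) (alpha : k) : seq (freealg k) :=
  let x1 := letter k 0 in let x2 := letter k 1 in
  let y1 := letter k 2 in let y2 := letter k 3 in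
  [:: x2 * x1 + x1 * x2;
      y2 * y1 + y1 * y2;
      y1 * x1 - x1 * y1;
      y1 * x2 - x2 * y2;
      y2 * x1 - x1 * y2;
      y2 * x2 - alpha *: (x2 * y1)].

Definition BK_ideal (k : fieldType) (alpha : k) :=
  two_sided_ideal_pred (BK_relators alpha).

HB.instance Definition _ (k : fieldType) (alpha : k) :=
  GRing.ZmodClosed.on (BK_ideal alpha).

Definition BK (k : fieldType) (alpha : k) : Type := {ideal_quot BK_ideal alpha}.

HB.instance Definition _ (k : fieldType) (alpha : k) :=
  GRing.Zmodule.on (BK alpha).

Section BKTheory.
Variables (k : fieldType) (alpha : k).
Local Notation F := (freealg k).
Local Notation B := (BK alpha).
Local Notation I := (BK_ideal alpha).

Definition toBK (f : F) : B := \pi_({ideal_quot I}) f.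
Definition BKlift (b : B) : F := repr (b : {ideal_quot I}).

Lemma BKliftK b : toBK (BKlift b) = b.
Proof. exact: reprK. Qed.

Lemma toBK_eq f g : (toBK f == toBK g) = (f - g \in I).
Proof. by rewrite Quotient.idealrBE. Qed.

Lemma BK_idealMl g f : f \in I -> g * f \in I.
Proof. exact: two_sided_idealMl. Qed.

Lemma BK_idealMr g f : f \in I -> f * g \in I.
Proof. exact: two_sided_idealMr. Qed.

Lemma BKlift_toBK f : f - BKlift (toBK f) \in I.
Proof. by rewrite -toBK_eq BKliftK. Qed.

Lemma toBKD f g : toBK (f + g) = toBK f + toBK g.
Proof. exact: Quotient.pi_add. Qed.

Lemma toBKN f : toBK (- f) = - toBK f.
Proof. exact: Quotient.pi_opp. Qed.

Definition BK_mul (a b : B) : B := toBK (BKlift a * BKlift b).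
Definition BK_scale (c : k) (a : B) : B := toBK (c *: BKlift a).

Lemma toBKM_def f g : toBK (f * g) = BK_mul (toBK f) (toBK g).
Proof.
apply/eqP; rewrite toBK_eq.
have -> : f * g - BKlift (toBK f) * BKlift (toBK g) =
   f * (g - BKlift (toBK g)) + (f - BKlift (toBK f)) * BKlift (toBK g).
  by rewrite mulrBr mulrBl addrA subrK.
by apply: rpredD; [apply: BK_idealMl | apply: BK_idealMr]; apply: BKlift_toBK.
Qed.

Lemma toBKZ_def c f : toBK (c *: f) = BK_scale c (toBK f).
Proof.
apply/eqP; rewrite toBK_eq -scalerBr -mul_malgC.
exact: BK_idealMl (BKlift_toBK f).
Qed.

Lemma BK_mulA : associative BK_mul.
Proof.
move=> a b c; rewrite -[a]BKliftK -[b]BKliftK -[c]BKliftK.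
by rewrite -!toBKM_def mulrA.
Qed.

Lemma BK_mul1l : left_id (toBK 1) BK_mul.
Proof. by move=> a; rewrite -[a]BKliftK -!toBKM_def mul1r. Qed.

Lemma BK_mul1r : right_id (toBK 1) BK_mul.
Proof. by move=> a; rewrite -[a]BKliftK -!toBKM_def mulr1. Qed.

Lemma BK_mulDl : left_distributive BK_mul +%R.
Proof.
move=> a b c; rewrite -[a]BKliftK -[b]BKliftK -[c]BKliftK.
by rewrite -toBKD -!toBKM_def -toBKD mulrDl.
Qed.

Lemma BK_mulDr : right_distributive BK_mul +%R.
Proof.
move=> a b c; rewrite -[a]BKliftK -[b]BKliftK -[c]BKliftK.
by rewrite -toBKD -!toBKM_def -toBKD mulrDr.
Qed.

Lemma mcoeff1M (f g : F) : (f * g)@_mone = f@_mone * g@_mone.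
Proof. exact: rmorphM. Qed.

Lemma mcoeff1_letter i : (letter k i)@_mone = 0.
Proof. by rewrite /letter mcoeffU1 fm1_eq1. Qed.

Lemma mcoeff1_relators r : r \in BK_relators alpha -> r@_mone = 0.
Proof.
have l0 i j : (letter k i * letter k j)@_mone = 0.
  by rewrite mcoeff1M !mcoeff1_letter mul0r.
have D0 (f g : F) : f@_mone = 0 -> g@_mone = 0 -> (f + g)@_mone = 0.
  by move=> f0 g0; rewrite mcoeffD f0 g0 addr0.
have N0 (f : F) : f@_mone = 0 -> (- f)@_mone = 0.
  by move=> f0; rewrite mcoeffN f0 oppr0.
have Z0 c (f : F) : f@_mone = 0 -> (c *: f)@_mone = 0.
  by move=> f0; rewrite mcoeffZ f0 mulr0.
rewrite /BK_relators !inE.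
do 5 (case/orP; first by move/eqP->; apply: D0; [|try apply: N0]; apply: l0).
by move/eqP->; apply: D0; [|apply: N0; apply: Z0]; apply: l0.
Qed.

Lemma BK_ideal_mcoeff1 f : f \in I -> f@_mone = 0.
Proof.
move=> /two_sided_idealP[s /allP Ss ->]; rewrite raddf_sum big_seq big1 //=.
by move=> t /Ss /mcoeff1_relators t0; rewrite !mcoeff1M t0 mulr0 mul0r.
Qed.

Lemma BK_1neq0 : toBK 1 != 0 :> B.
Proof.
have -> : 0 = toBK 0 :> B by rewrite -[0 in RHS](subrr 0) toBKD toBKN subrr.
rewrite toBK_eq subr0; apply/negP => /BK_ideal_mcoeff1/eqP.
by rewrite mcoeff1 eqxx oner_eq0.
Qed.

HB.instance Definition _ := GRing.Zmodule_isNzRing.Build B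
  BK_mulA BK_mul1l BK_mul1r BK_mulDl BK_mulDr BK_1neq0.

Lemma BK_scaleA c d a : BK_scale c (BK_scale d a) = BK_scale (c * d) a.
Proof. by rewrite -[a]BKliftK -!toBKZ_def scalerA. Qed.

Lemma BK_scale1 : left_id 1 BK_scale.
Proof. by move=> a; rewrite -[a]BKliftK -!toBKZ_def scale1r. Qed.

Lemma BK_scaleDr : right_distributive BK_scale +%R.
Proof.
move=> c a b; rewrite -[a]BKliftK -[b]BKliftK.
by rewrite -toBKD -!toBKZ_def -toBKD scalerDr.
Qed.

Lemma BK_scaleDl a : {morph BK_scale^~ a : c d / c + d}.
Proof.
by move=> c d; rewrite -[a]BKliftK -!toBKZ_def -toBKD scalerDl.
Qed.

HB.instance Definition _ := GRing.Zmodule_isLmodule.Build k B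
  BK_scaleA BK_scale1 BK_scaleDr BK_scaleDl.

Lemma BK_scaleAl c (a b : B) : c *: (a * b) = c *: a * b.
Proof.
rewrite -[a]BKliftK -[b]BKliftK -[_ * _]toBKM_def -[LHS]toBKZ_def.
by rewrite -[c *: toBK _]toBKZ_def -[RHS]toBKM_def scalerAl.
Qed.

HB.instance Definition _ := GRing.Lmodule_isLalgebra.Build k B BK_scaleAl.

Lemma BK_scaleAr c (a b : B) : c *: (a * b) = a * (c *: b).
Proof.
have scalerAr_free (f g : F) : c *: (f * g) = f * (c *: g).
  have comm_c : f * c%:MP = c *: f.
    rewrite malgM_def fgmulgU malgZ_def; apply: eq_bigr => m _.
    by rewrite mulm1 mulrC.
  by rewrite -(mul_malgC c g) mulrA comm_c scalerAl.
rewrite -[a]BKliftK -[b]BKliftK -[_ * _]toBKM_def -[LHS]toBKZ_def.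
by rewrite -[c *: toBK _]toBKZ_def -[RHS]toBKM_def scalerAr_free.
Qed.

HB.instance Definition _ := GRing.Lalgebra_isAlgebra.Build k B BK_scaleAr.

Lemma toBKM f g : toBK (f * g) = toBK f * toBK g.
Proof. exact: toBKM_def. Qed.

Lemma toBKZ c f : toBK (c *: f) = c *: toBK f.
Proof. exact: toBKZ_def. Qed.

HB.instance Definition _ := GRing.isZmodMorphism.Build F B toBK
  (fun f g => etrans (toBKD f (- g)) (congr1 (+%R (toBK f)) (toBKN g))).
HB.instance Definition _ := GRing.isMonoidMorphism.Build F B toBK
  (conj (erefl _) toBKM).
HB.instance Definition _ := GRing.isScalable.Build k F B *:%R toBK toBKZ.

Lemma toBK_relator r : r \in BK_relators alpha -> toBK r = 0.
Proof.
move=> r_in; rewrite -(rmorph0 toBK); apply/eqP; rewrite toBK_eq subr0.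
apply/two_sided_idealP; exists [:: (1, r, 1)]; first by rewrite /= r_in.
by rewrite big_seq1 mul1r mulr1.
Qed.

Definition BKx1 : B := toBK (letter k 0).
Definition BKx2 : B := toBK (letter k 1).
Definition BKy1 : B := toBK (letter k 2).
Definition BKy2 : B := toBK (letter k 3).

(* The homogeneous component of degree d. *)
Definition BK_homog (d : int) (b : B) : Prop :=
  exists2 f : F, (forall m, m \in msupp f -> (fdeg m)%:Z = d) & b = toBK f.

Definition BK_ge1 (b : B) : Prop :=
  exists n (c : nat -> B),
    (forall i, BK_homog i.+1 (c i)) /\ b = \sum_(i < n) c i.

(* The augmentation B -> k: the constant term of any representative. *)
Definition BK_aug (b : B) : k := (BKlift b)@_mone.

Lemma BK_aug_toBK f : BK_aug (toBK f) = f@_mone.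
Proof.
by apply/esym/eqP; rewrite -subr_eq0 -mcoeffB (BK_ideal_mcoeff1 (BKlift_toBK f)).
Qed.

Lemma BK_aug_is_zmod_morphism : zmod_morphism BK_aug.
Proof.
move=> a b; rewrite -[a]BKliftK -[b]BKliftK -rmorphB.
by rewrite !BK_aug_toBK mcoeffB.
Qed.

Lemma BK_aug_is_monoid_morphism : monoid_morphism BK_aug.
Proof.
split; first by rewrite -[1]/(toBK 1) BK_aug_toBK mcoeff1 eqxx.
move=> a b; rewrite -[a]BKliftK -[b]BKliftK -toBKM.
by rewrite !BK_aug_toBK mcoeff1M.
Qed.

HB.instance Definition _ :=
  GRing.isZmodMorphism.Build B k BK_aug BK_aug_is_zmod_morphism.
HB.instance Definition _ :=
  GRing.isMonoidMorphism.Build B k BK_aug BK_aug_is_monoid_morphism.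

Lemma BK_aug_eq0 b : BK_aug b = 0 <-> BK_ge1 b.
Proof.
split=> [b0 | [n [c [c_hom ->]]]]; last first.
  rewrite rmorph_sum big1 // => i _; have [f f_hom ->] := c_hom i.
  rewrite /= BK_aug_toBK; apply: mcoeff_outdom; apply/negP => /f_hom.
  by rewrite fdeg1.
pose f := BKlift b.
pose c i := \sum_(m <- msupp f | fdeg m == i.+1) << f@_m *g m >>.
exists (\max_(m <- msupp f) fdeg m)%N, (fun i => toBK (c i)); split.
  move=> i; exists (c i) => // m; rewrite -mcoeff_neq0 /c raddf_sum /=.
  case: (eqVneq (fdeg m) i.+1) => [-> // | m_deg].
  rewrite big1 ?eqxx // => m' /eqP m'_deg; rewrite mcoeffU.
  by case: eqP => // mm'; rewrite -mm' m'_deg eqxx in m_deg.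
rewrite -rmorph_sum -[LHS]BKliftK; congr (toBK _); rewrite -/f.
rewrite [LHS]monalgE /c (exchange_big_dep xpredT) //=.
apply: eq_big_seq => m m_f; have m_n : fdeg m != 0%N.
  apply: contraTneq m_f => /fdeg_eq0I ->.
  by rewrite -mcoeff_neq0 negbK; apply/eqP.
have m_lt : ((fdeg m).-1 < \max_(m <- msupp f) fdeg m)%N.
  by rewrite prednK ?lt0n // (big_rem m) //= leq_max leqnn.
rewrite (big_pred1 (Ordinal m_lt)) // => i.
by rewrite /= -val_eqE /= -{1}[fdeg m]prednK ?lt0n // eqSS eq_sym.
Qed.

End BKTheory.

Section GradedModules.
Variables (k : fieldType) (alpha : k).
Local Notation B := (BK alpha).

(* A right B-module is a left module over the converse ring B^c: the right
   action of b on u is written (b : B^c) *: u. *)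
Record grmodule := GrModule {
  grm_sort :> lmodType B^c;
  grm_homog : int -> grm_sort -> Prop;
  grm_homog0 : forall d, grm_homog d 0;
  grm_homogB : forall d u v,
    grm_homog d u -> grm_homog d v -> grm_homog d (u - v);
  grm_homogZ : forall d e u (b : B),
    grm_homog d u -> BK_homog e b -> grm_homog (d + e) ((b : B^c) *: u);
  grm_decomp : forall u, exists (s : seq int) (c : int -> grm_sort),
    (forall d, grm_homog d (c d)) /\ u = \sum_(d <- s) c d;
  grm_direct : forall (s : seq int) (c : int -> grm_sort), uniq s ->
    (forall d, grm_homog d (c d)) -> \sum_(d <- s) c d = 0 ->
    forall d, d \in s -> c d = 0
}.

(* The trivial right module B / B_{>=1}, realised on k through the
   augmentation, whose kernel is B_{>=1} by BK_aug_eq0. *)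
Definition trivmod : Type := k.

HB.instance Definition _ := GRing.Zmodule.on trivmod.

Definition trivmod_scale (b : B^c) (c : trivmod) : trivmod :=
  (c : k) * BK_aug (b : B).

Lemma trivmod_scaleA a b c :
  trivmod_scale a (trivmod_scale b c) = trivmod_scale (a * b) c.
Proof.
by rewrite /trivmod_scale -mulrA -(rmorphM (@BK_aug k alpha)).
Qed.

Lemma trivmod_scale1 : left_id 1 trivmod_scale.
Proof.
by move=> c; rewrite /trivmod_scale (rmorph1 (@BK_aug k alpha)) mulr1.
Qed.

Lemma trivmod_scaleDr : right_distributive trivmod_scale +%R.
Proof. by move=> b c d; apply: mulrDl. Qed.

Lemma trivmod_scaleDl c : {morph trivmod_scale^~ c : a b / a + b}.
Proof.
by move=> a b; rewrite /trivmod_scale (rmorphD (@BK_aug k alpha)) mulrDr.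
Qed.

HB.instance Definition _ := GRing.Zmodule_isLmodule.Build B^c trivmod
  trivmod_scaleA trivmod_scale1 trivmod_scaleDr trivmod_scaleDl.

Definition trivmod_homog (d : int) (c : trivmod) : Prop := d = 0 \/ c = 0.

Lemma trivmod_homog0 d : trivmod_homog d 0.
Proof. by right. Qed.

Lemma trivmod_homogB d u v :
  trivmod_homog d u -> trivmod_homog d v -> trivmod_homog d (u - v).
Proof. by move=> [->|->] [d0|->]; [left|left|left|right; rewrite subrr]. Qed.

Lemma trivmod_homogZ d e u (b : B) :
  trivmod_homog d u -> BK_homog e b ->
  trivmod_homog (d + e) ((b : B^c) *: u).
Proof.
move=> [->|->] [f f_hom ->]; last by right; apply: scaler0.
rewrite add0r; have [->|e0] := eqVneq e 0; first by left.
right; apply/eqP; rewrite mulf_eq0; apply/orP; right; apply/eqP.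
rewrite BK_aug_toBK; apply: mcoeff_outdom; apply/negP => /f_hom.
by rewrite fdeg1 => /esym/eqP; rewrite (negPf e0).
Qed.

Lemma trivmod_decomp u : exists (s : seq int) (c : int -> trivmod),
  (forall d, trivmod_homog d (c d)) /\ u = \sum_(d <- s) c d.
Proof.
exists [:: 0], (fun d => if d == 0 then u else 0).
split=> [d|]; last by rewrite big_seq1 eqxx.
by case: eqP => [->|_]; [left|right].
Qed.

Lemma trivmod_direct (s : seq int) (c : int -> trivmod) : uniq s ->
  (forall d, trivmod_homog d (c d)) -> \sum_(d <- s) c d = 0 ->
  forall d, d \in s -> c d = 0.
Proof.
move=> s_uniq c_hom sum0 d d_s; have [d0|//] := c_hom d.
rewrite -sum0 (big_rem d) //= big_seq big1 ?addr0 // => e.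
rewrite mem_rem_uniq // !inE d0 => /andP[e0 _].
by have [e_eq0|//] := c_hom e; rewrite e_eq0 eqxx in e0.
Qed.

Definition kB : grmodule := @GrModule trivmod trivmod_homog trivmod_homog0
  trivmod_homogB trivmod_homogZ trivmod_decomp trivmod_direct.

(* A sequence F_0 <- F_1 <- ... of finitely generated graded free right
   modules: F_i is the direct sum over l : 'I_(rk i) of the B(- gen_deg i l),
   its elements are columns, and diff i : F_(i.+1) -> F_i is left
   multiplication by a matrix. *)
Record free_sequence := FreeSequence {
  rk : nat -> nat;
  gen_deg : forall i, 'I_(rk i) -> int;
  diff : forall i, 'M[B]_(rk i, rk i.+1)
}.
Implicit Type F : free_sequence.

(* B(-a)_d = B_(d - a). *)
Definition free_homog F i (d : int) (v : 'cV[B]_(rk F i)) : Prop :=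
  forall l, BK_homog (d - gen_deg l) (v l 0).

Definition graded_free_resolution F (M : grmodule)
    (aug : {linear 'cV[B^c]_(rk F 0) -> M}) : Prop :=
  [/\ forall i d v, free_homog d v -> free_homog d (diff F i *m v),
      forall d v, @free_homog F 0 d v -> grm_homog d (aug v),
      forall u, exists v, aug v = u,
      forall v, aug v = 0 <-> exists w, v = diff F 0 *m w
    & forall i (v : 'cV[B]_(rk F i.+1)),
        diff F i *m v = 0 <-> exists w, v = diff F i.+1 *m w].

(* w lies in the submodule F_i B_{>=1}. *)
Definition in_FB_ge1 F i (w : 'cV[B]_(rk F i)) : Prop :=
  exists n (v : 'I_n -> 'cV[B]_(rk F i)) (b : 'I_n -> B),
    (forall l, BK_ge1 (b l)) /\ w = \sum_l v l *m (b l)%:M.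

Definition minimal_graded_free_resolution F (M : grmodule)
    (aug : {linear 'cV[B^c]_(rk F 0) -> M}) : Prop :=
  graded_free_resolution aug /\
  forall i (v : 'cV[B]_(rk F i.+1)), in_FB_ge1 (diff F i *m v).

(* Since B(-a) (x)_B k = k(-a), the complex F (x)_B k has the space k^(rk i) in
   position i, with the l-th basis vector in degree gen_deg i l, and its
   differentials are the matrices diff i reduced by the augmentation. *)
Definition tensor_diff F i : 'M[k]_(rk F i, rk F i.+1) :=
  map_mx (@BK_aug k alpha) (diff F i).

Definition tensor_part F i (j : int) : {vspace 'cV[k]_(rk F i)} :=
  <<[seq delta_mx l ord0 | l <- enum 'I_(rk F i) & gen_deg l == j]>>%VS.

Definition tensor_cycles F i (j : int) : {vspace 'cV[k]_(rk F i)} :=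
  match i with
  | 0 => tensor_part F 0 j
  | i'.+1 => (tensor_part F i'.+1 j :&: lker (linfun (mulmx (tensor_diff F i'))))%VS
  end.

Definition tensor_boundaries F i (j : int) : {vspace 'cV[k]_(rk F i)} :=
  (linfun (mulmx (tensor_diff F i)) @: tensor_part F i.+1 j)%VS.

(* The dimension of H_i(F (x)_B k)_j. *)
Definition tensor_homology_dim F i (j : int) : nat :=
  (\dim (tensor_cycles F i j) - \dim (tensor_boundaries F i j))%N.

(* dim Tor_i^B(M, k)_j, computed from a chosen graded free resolution of M
   (junk value 0 when M has none by finitely generated free modules). *)
Definition betti (M : grmodule) i (j : int) : nat :=
  if pselect (exists F (aug : {linear 'cV[B^c]_(rk F 0) -> M}),
                graded_free_resolution aug) is left F_ex
  then tensor_homology_dim (sval (cid F_ex)) i j else 0%N.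

End GradedModules.

Section KoszulSequence.
Variables (k : fieldType) (alpha : k).
Local Notation B := (BK alpha).
Local Notation x1 := (BKx1 alpha).
Local Notation x2 := (BKx2 alpha).
Local Notation y1 := (BKy1 alpha).
Local Notation y2 := (BKy2 alpha).

Definition mx_of_rows m n (rows : seq (seq B)) : 'M[B]_(m, n) :=
  \matrix_(i, j) (nth [::] rows i)`_j.

Definition BK_d1 : 'M[B]_(1, 4) := mx_of_rows 1 4
  [:: [:: x1; x2; y1; y2]].

Definition BK_d2 : 'M[B]_(4, 6) := mx_of_rows 4 6
  [:: [:: x2;  0; - y1;    0; - y2;               0];
      [:: x1;  0;    0; - y2;    0; - (alpha *: y1)];
      [::  0; y2;   x1;   x2;    0;               0];
      [::  0; y1;    0;    0;   x1;              x2]].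

Definition BK_d3 : 'M[B]_(6, 4) := mx_of_rows 6 4
  [:: [:: y2; alpha *: y1;    0;               0];
      [::  0;           0;   x1;              x2];
      [:: x2;           0; - y2;               0];
      [:: x1;           0;    0; - (alpha *: y1)];
      [::  0;          x2; - y1;               0];
      [::  0;          x1;    0;            - y2]].

Definition BK_d4 : 'M[B]_(4, 1) := mx_of_rows 4 1
  [:: [:: alpha *: y1]; [:: y2]; [:: x2]; [:: x1]].

Definition BK_rk (i : nat) : nat := nth 0%N [:: 1; 4; 6; 4; 1]%N i.

Definition BK_diff (i : nat) : 'M[B]_(BK_rk i, BK_rk i.+1) :=
  match i with
  | 0 => BK_d1
  | 1 => BK_d2
  | 2 => BK_d3
  | 3 => BK_d4
  | _ => 0
  end.

(* 0 -> B(-4) -> B(-3)^4 -> B(-2)^6 -> B(-1)^4 -> B, continued by zero. *)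
Definition BK_sequence : free_sequence alpha :=
  FreeSequence (fun i (_ : 'I_(BK_rk i)) => i%:Z) BK_diff.

Definition BK_seq_aug (v : 'cV[B^c]_(rk BK_sequence 0)) : kB alpha :=
  BK_aug (v 0 0 : B).

Lemma BK_seq_aug_zmod_morphism : zmod_morphism BK_seq_aug.
Proof. by move=> u v; rewrite /BK_seq_aug !mxE; apply: (rmorphB (@BK_aug k alpha)). Qed.

Lemma BK_seq_aug_scalable : scalable BK_seq_aug.
Proof. by move=> b v; rewrite /BK_seq_aug mxE; apply: (rmorphM (@BK_aug k alpha)). Qed.

HB.instance Definition _ := GRing.isZmodMorphism.Build
  'cV[B^c]_(rk BK_sequence 0) (kB alpha) BK_seq_aug BK_seq_aug_zmod_morphism.
HB.instance Definition _ := GRing.isScalable.Build B^c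
  'cV[B^c]_(rk BK_sequence 0) (kB alpha) *:%R BK_seq_aug BK_seq_aug_scalable.

End KoszulSequence.

(* Main.v *)
Require Import Defs.
From HB Require Import structures.
From mathcomp Require Import all_boot all_order all_algebra.
From mathcomp Require Import finmap boolp.
From mathcomp.multinomials Require Import monalg.
From mathcomp Require Import zify ring.

Set Implicit Arguments.
Unset Strict Implicit.
Unset Printing Implicit Defensive.
Import GRing.Theory.
Local Open Scope ring_scope.

(** Moving every x to the left of every y with the relations writes each product
    as a scalar multiple of an ordered monomial x1^a x2^b y1^c y2^d, and these
    monomials form a basis of B. To see this, left multiplication by the
    generators is written as four explicit operators on formal combinations of
    ordered monomials; they satisfy the six relations, so B acts, and letting b
    act on the empty monomial gives coordinates inverse to evaluation
    ([pbw_evalK], [BKcoordK]).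

    The complex is the total complex of a double complex: in one direction the
    skew Koszul complex of x1, x2, in the other the one of y1, y2. Its exactness
    therefore needs only five facts about left multiplication in B: x1 and x2
    are regular, a syzygy of x1 and x2 is a multiple of the obvious one
    ([BK_x_syz]), and modulo x1 B + x2 B the element y1 is regular and a syzygy of
    y1 and y2 is again a multiple of the obvious one ([BK_y1_reg], [BK_y_syz]).
    On ordered monomials each operator has an explicit partial inverse, which
    gives these facts. A cycle is then cleared one block of coordinates at a
    time ([exact12], [exact23], [exact34], [exact4]). Minimality holds because
    every entry of every differential has augmentation 0.

    The Betti numbers refer to some unspecified graded resolution, so they are
    first shown to be independent of it. Two graded free resolutions are related
    by graded chain maps, unique up to graded homotopy ([chain_map],
    [null_homotopy]); reducing by the augmentation bounds the dimension of each
    homology space by the other ([tensor_homology_dim_le]). The lifts can be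
    kept graded because B is the direct sum of its homogeneous components and
    taking components commutes with multiplication by homogeneous elements
    ([hcompM]). For the complex above the reduced differentials vanish, and the
    Betti numbers are the ranks. *)

(** * Linear maps on free vector spaces *)

Section LinearExtension.
Variables (k : fieldType) (K : choiceType) (U : lmodType k).

(** The free algebra and the space of ordered monomials are both free on their
    monomials, so this one operation defines every linear map used below. *)
Definition linear_extension (h : K -> U) (g : {malg k[K]}) : U :=
  \sum_(m <- msupp g) g@_m *: h m.

Lemma linear_extensionEw h (d : {fset K}) g : (msupp g `<=` d)%fset ->
  linear_extension h g = \sum_(m <- d) g@_m *: h m.
Proof.
move=> g_d; rewrite /linear_extension (big_fset_incl _ g_d) // => m _.
by rewrite -mcoeff_eq0 => /eqP->; rewrite scale0r.
Qed.

Lemma linear_extension_is_linear h : linear (linear_extension h).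
Proof.
move=> c u v; pose d := (msupp (c *: u + v) `|` (msupp u `|` msupp v))%fset.
rewrite (@linear_extensionEw h d) ?fsubsetUl //.
rewrite (@linear_extensionEw h d u); last first.
  by rewrite /d fsetUCA fsubsetUl.
rewrite (@linear_extensionEw h d v); last by rewrite /d fsetUA fsubsetUr.
rewrite scaler_sumr -big_split; apply: eq_bigr => m _ /=.
by rewrite mcoeffD mcoeffZ scalerDl scalerA.
Qed.

HB.instance Definition _ h :=
  GRing.isLinear.Build k {malg k[K]} U *:%R
    (linear_extension h) (linear_extension_is_linear h).

Lemma linear_extensionU h m : linear_extension h << m >> = h m.
Proof.
rewrite (@linear_extensionEw h [fset m]%fset) ?msuppU_le // big_seq_fset1.
by rewrite mcoeffUU scale1r.
Qed.

Lemma malgUE c (m : K) : << c *g m >> = c *: << m >> :> {malg k[K]}.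
Proof. by apply/malgP => n; rewrite mcoeffZ !mcoeffU mulrnAr mulr1. Qed.

Lemma malg_sum (g : {malg k[K]}) : g = \sum_(m <- msupp g) g@_m *: << m >>.
Proof. by rewrite [LHS]monalgE; apply: eq_bigr => m _; apply: malgUE. Qed.

Lemma linear_ext (f g : {linear {malg k[K]} -> U}) :
  (forall m, f << m >> = g << m >>) -> f =1 g.
Proof.
move=> fg v; rewrite [v]malg_sum !linear_sum; apply: eq_bigr => m _.
by rewrite !linearZ fg.
Qed.

End LinearExtension.

(** * The generators as operators on ordered monomials *)

Section Model.
Variables (k : fieldType) (alpha : k).

(** The tuple (a, b, c, d) stands for x1^a x2^b y1^c y2^d. *)
Definition pbw_index : Type := (nat * nat * nat * nat)%type.
HB.instance Definition _ := Choice.on pbw_index.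
Local Notation V := {malg k[pbw_index]}.
Implicit Types (v : V).

Definition mon (a b c d : nat) : V := << ((a, b, c, d) : pbw_index) >>.

Definition on_mon (W : lmodType k) (h : nat -> nat -> nat -> nat -> W) :
    V -> W :=
  linear_extension (fun t : pbw_index => let: (a, b, c, d) := t in h a b c d).
HB.instance Definition _ W h := GRing.Linear.on (@on_mon W h).

Lemma on_monE (W : lmodType k) (h : nat -> nat -> nat -> nat -> W) a b c d :
  on_mon h (mon a b c d) = h a b c d.
Proof. by rewrite /on_mon linear_extensionU. Qed.

Lemma mon_ext (W : lmodType k) (f g : {linear V -> W}) :
  (forall a b c d, f (mon a b c d) = g (mon a b c d)) -> f =1 g.
Proof. by move=> fg; apply: linear_ext => -[[[a b] c] d]; apply: fg. Qed.

(** Left multiplication by the generators, written on ordered monomials. Moving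
    a y past x2 exchanges y1 and y2, with a factor alpha each time y2 becomes y1:
    hence the parity of b, and the powers of alpha, which count how often this
    happens. The signs come from x2 x1 = - x1 x2 and y2 y1 = - y1 y2. *)
Definition X1 := on_mon (fun a b c d => mon a.+1 b c d).
Definition X2 := on_mon (fun a b c d => (-1) ^+ a *: mon a b.+1 c d).
Definition Y1 := on_mon (fun a b c d => alpha ^+ b./2 *:
  if odd b then (-1) ^+ c *: mon a b c d.+1 else mon a b c.+1 d).
Definition Y2 := on_mon (fun a b c d => alpha ^+ uphalf b *:
  if odd b then mon a b c.+1 d else (-1) ^+ c *: mon a b c d.+1).

HB.instance Definition _ := GRing.Linear.on X1.
HB.instance Definition _ := GRing.Linear.on X2.
HB.instance Definition _ := GRing.Linear.on Y1.
HB.instance Definition _ := GRing.Linear.on Y2.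

Lemma X1E a b c d : X1 (mon a b c d) = mon a.+1 b c d.
Proof. exact: on_monE. Qed.
Lemma X2E a b c d : X2 (mon a b c d) = (-1) ^+ a *: mon a b.+1 c d.
Proof. exact: on_monE. Qed.
Lemma Y1E a b c d : Y1 (mon a b c d) = alpha ^+ b./2 *:
  if odd b then (-1) ^+ c *: mon a b c d.+1 else mon a b c.+1 d.
Proof. exact: on_monE. Qed.
Lemma Y2E a b c d : Y2 (mon a b c d) = alpha ^+ uphalf b *:
  if odd b then mon a b c.+1 d else (-1) ^+ c *: mon a b c d.+1.
Proof. exact: on_monE. Qed.
Definition opE := (X1E, X2E, Y1E, Y2E).

(** The six relations of B hold for these operators; this is where the
    consistency of the rewriting to ordered monomials is checked. *)
Lemma X2X1 v : X2 (X1 v) = - X1 (X2 v).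
Proof.
apply: (mon_ext (f := X2 \o X1) (g := \- (X1 \o X2))) v => a b c d /=.
by rewrite !opE linearZ /= opE exprS mulN1r scaleNr.
Qed.

Lemma Y2Y1 v : Y2 (Y1 v) = - Y1 (Y2 v).
Proof.
apply: (mon_ext (f := Y2 \o Y1) (g := \- (Y1 \o Y2))) v => a b c d /=.
rewrite !opE !linearZ /=; case b_odd: (odd b).
  rewrite linearZ /= !opE b_odd scalerN -scaleNr !scalerA; congr (_ *: _).
  by rewrite exprS; ring.
rewrite linearZ /= !opE b_odd scalerN -scaleNr !scalerA; congr (_ *: _).
by rewrite exprS; ring.
Qed.

Lemma Y1X1 v : Y1 (X1 v) = X1 (Y1 v).
Proof.
apply: (mon_ext (f := Y1 \o X1) (g := X1 \o Y1)) v => a b c d /=.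
by rewrite !opE linearZ /=; case: odd; rewrite ?linearZ /= !opE.
Qed.
Lemma Y2X1 v : Y2 (X1 v) = X1 (Y2 v).
Proof.
apply: (mon_ext (f := Y2 \o X1) (g := X1 \o Y2)) v => a b c d /=.
by rewrite !opE linearZ /=; case: odd; rewrite ?linearZ /= !opE.
Qed.
Lemma Y1X2 v : Y1 (X2 v) = X2 (Y2 v).
Proof.
apply: (mon_ext (f := Y1 \o X2) (g := X2 \o Y2)) v => a b c d /=.
rewrite !opE !linearZ /= !opE /=; case: odd;
  by rewrite ?linearZ /= ?opE ?scalerA; congr (_ *: _); ring.
Qed.
Lemma Y2X2 v : Y2 (X2 v) = alpha *: X2 (Y1 v).
Proof.
apply: (mon_ext (f := Y2 \o X2) (g := alpha \*: (X2 \o Y1))) v => a b c d /=.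
rewrite !opE !linearZ /= !opE /=; case: odd;
  by rewrite ?linearZ /= ?opE ?scalerA; congr (_ *: _); rewrite exprS; ring.
Qed.

End Model.

(** * Evaluating ordered monomials in an algebra with the same relations *)

Section Expand.
Variables (k : fieldType) (alpha : k) (A : algType k) (x1 x2 y1 y2 : A).
Hypotheses (x2x1 : x2 * x1 = - (x1 * x2)) (y2y1 : y2 * y1 = - (y1 * y2))
  (y1x1 : y1 * x1 = x1 * y1) (y1x2 : y1 * x2 = x2 * y2)
  (y2x1 : y2 * x1 = x1 * y2) (y2x2 : y2 * x2 = alpha *: (x2 * y1)).
Local Notation V := {malg k[pbw_index]}.
Implicit Types (v : V).

Definition pbw_eval : V -> A :=
  on_mon (fun a b c d => x1 ^+ a * x2 ^+ b * y1 ^+ c * y2 ^+ d).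
HB.instance Definition _ := GRing.Linear.on pbw_eval.

Lemma pbw_evalE a b c d :
  pbw_eval (mon k a b c d) = x1 ^+ a * x2 ^+ b * y1 ^+ c * y2 ^+ d.
Proof. exact: on_monE. Qed.

Lemma skew_commX (x y : A) n : y * x = - (x * y) ->
  y * x ^+ n = (-1) ^+ n *: (x ^+ n * y).
Proof.
move=> yx; elim: n => [|n IHn]; first by rewrite mulr1 mul1r scale1r.
rewrite (exprS x) mulrA yx mulNr -(mulrA x y) IHn -scalerAr mulrA.
by rewrite exprS mulN1r scaleNr.
Qed.

Lemma y1x1n a : y1 * x1 ^+ a = x1 ^+ a * y1.
Proof. exact/commrX/y1x1. Qed.

Lemma y2x1n a : y2 * x1 ^+ a = x1 ^+ a * y2.
Proof. exact/commrX/y2x1. Qed.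

(** The two identities feed each other, since passing x2 exchanges y1 and y2;
    they explain the coefficients in [Y1] and [Y2]. *)
Lemma yx2n b :
  y1 * x2 ^+ b = alpha ^+ b./2 *: (x2 ^+ b * (if odd b then y2 else y1)) /\
  y2 * x2 ^+ b = alpha ^+ uphalf b *: (x2 ^+ b * (if odd b then y1 else y2)).
Proof.
elim: b => [|b [IH1 IH2]]; first by rewrite !mulr1 !mul1r !scale1r.
split.
  by rewrite exprS mulrA y1x2 -(mulrA x2 y2) IH2 -scalerAr mulrA /=; case: odd.
rewrite (exprS x2) mulrA y2x2 -scalerAl -(mulrA x2 y1) IH1 -scalerAr scalerA.
by rewrite mulrA exprS /=; case: odd.
Qed.

(** Evaluation turns each operator into multiplication by the corresponding
    element: reordering inside the algebra follows the same rules. *)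
Lemma pbw_eval_X1 v : pbw_eval (X1 v) = x1 * pbw_eval v.
Proof.
apply: (mon_ext (f := pbw_eval \o @X1 k) (g := x1 \*o pbw_eval)) => a b c d /=.
by rewrite !opE !pbw_evalE exprS !mulrA.
Qed.

Lemma pbw_eval_X2 v : pbw_eval (X2 v) = x2 * pbw_eval v.
Proof.
apply: (mon_ext (f := pbw_eval \o @X2 k) (g := x2 \*o pbw_eval)) => a b c d /=.
rewrite !opE linearZ /= !pbw_evalE !mulrA (skew_commX a x2x1) -!scalerAl.
by rewrite (exprS x2) !mulrA.
Qed.

Lemma pbw_eval_Y1 v : pbw_eval (Y1 alpha v) = y1 * pbw_eval v.
Proof.
apply: (mon_ext (f := pbw_eval \o Y1 alpha) (g := y1 \*o pbw_eval)) => a b c d /=.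
rewrite !opE linearZ /= pbw_evalE !mulrA y1x1n -(mulrA _ y1) (yx2n b).1.
rewrite -scalerAr -!scalerAl; congr (_ *: _); case: odd.
  rewrite linearZ /= pbw_evalE exprS !mulrA -(mulrA _ y2 (y1 ^+ c)).
  rewrite (skew_commX c y2y1).
  by rewrite -scalerAr -scalerAl !mulrA.
by rewrite pbw_evalE exprS !mulrA.
Qed.

Lemma pbw_eval_Y2 v : pbw_eval (Y2 alpha v) = y2 * pbw_eval v.
Proof.
apply: (mon_ext (f := pbw_eval \o Y2 alpha) (g := y2 \*o pbw_eval)) => a b c d /=.
rewrite !opE linearZ /= pbw_evalE !mulrA y2x1n -(mulrA _ y2) (yx2n b).2.
rewrite -scalerAr -!scalerAl; congr (_ *: _); case: odd.
  by rewrite pbw_evalE exprS !mulrA.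
rewrite linearZ /= pbw_evalE exprS !mulrA -(mulrA _ y2 (y1 ^+ c)).
rewrite (skew_commX c y2y1).
by rewrite -scalerAr -scalerAl !mulrA.
Qed.

End Expand.

(** * The basis of ordered monomials *)

Section Coordinates.
Variables (k : fieldType) (alpha : k).
Local Notation V := {malg k[pbw_index]}.
Implicit Types (v : V).
Local Notation mon := (@mon k).
Local Notation X1 := (@X1 k).
Local Notation X2 := (@X2 k).
Local Notation Y1 := (@Y1 k alpha).
Local Notation Y2 := (@Y2 k alpha).

Definition letter_op (i : 'I_4) : V -> V := nth X1 [:: X1; X2; Y1; Y2] i.

Lemma letter_op_is_linear i : linear (letter_op i).
Proof. by case: i => -[|[|[|[|//]]]] ? c u v; rewrite /letter_op /= linearP. Qed.
HB.instance Definition _ i :=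
  GRing.isLinear.Build k V V *:%R (letter_op i) (letter_op_is_linear i).

Definition word_act (w : seq 'I_4) (v : V) : V := foldr letter_op v w.

Lemma word_act_is_linear w : linear (word_act w).
Proof.
elim: w => [//|i w IHw] c u v.
by rewrite [LHS](congr1 (letter_op i) (IHw c u v)) linearP.
Qed.
HB.instance Definition _ w :=
  GRing.isLinear.Build k V V *:%R (word_act w) (word_act_is_linear w).

(** The free algebra acts because its monomials are words; the argument order
    makes it linear in the algebra element. *)
Definition free_act (v : V) : freealg k -> V :=
  linear_extension (fun w : {fmonom 'I_4} => word_act w v).
HB.instance Definition _ v := GRing.Linear.on (free_act v).

Lemma free_act0 f : free_act 0 f = 0.
Proof.
by rewrite /free_act /linear_extension big1 // => w _; rewrite linear0 scaler0.
Qed.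

Lemma free_actM f g v : free_act v (f * g) = free_act (free_act v g) f.
Proof.
have actUU (c e : k) (w u : {fmonom 'I_4}) :
    free_act v (<< c *g w >> * << e *g u >>) = c *: word_act w (e *: word_act u v).
  rewrite malgM_def fgmulUU malgUE (linearZ_LR (free_act v)) /= /free_act.
  rewrite linear_extensionU.
  by rewrite fmM /word_act foldr_cat -!/(word_act _ _) linearZ_LR scalerA.
rewrite {1}[f]monalgE {1}[g]monalgE mulr_suml linear_sum.
apply: eq_bigr => w _; rewrite mulr_sumr linear_sum.
rewrite [free_act v g]/linear_extension linear_sum.
by rewrite scaler_sumr; apply: eq_bigr => u _; apply: actUU.
Qed.

Lemma free_act_letter i v : (i < 4)%N ->
  free_act v (letter k i) = nth X1 [:: X1; X2; Y1; Y2] i v.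
Proof. by move=> i4; rewrite /free_act linear_extensionU fmuE /= /letter_op inordK. Qed.

Lemma free_actB v f g : free_act v (f - g) = free_act v f - free_act v g.
Proof. exact: raddfB. Qed.
Lemma free_actD v f g : free_act v (f + g) = free_act v f + free_act v g.
Proof. exact: raddfD. Qed.
Lemma free_actZ v c f : free_act v (c *: f) = c *: free_act v f.
Proof. exact: linearZ_LR. Qed.

Lemma free_act_relator r v : r \in BK_relators alpha -> free_act v r = 0.
Proof.
have a0 u : free_act u (letter k 0) = X1 u by exact: free_act_letter.
have a1 u : free_act u (letter k 1) = X2 u by exact: free_act_letter.
have a2 u : free_act u (letter k 2) = Y1 u by exact: free_act_letter.
have a3 u : free_act u (letter k 3) = Y2 u by exact: free_act_letter.
rewrite /BK_relators !inE.
move: (letter k 0) (letter k 1) (letter k 2) (letter k 3) a0 a1 a2 a3.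
move=> l0 l1 l2 l3 a0 a1 a2 a3.
have addE f g f' g' : free_act v (f * g + f' * g') =
    free_act (free_act v g) f + free_act (free_act v g') f'.
  by apply: etrans (free_actD _ _ _) _; congr (_ + _); apply: free_actM.
have subE f g f' g' : free_act v (f * g - f' * g') =
    free_act (free_act v g) f - free_act (free_act v g') f'.
  apply: etrans (free_actB _ _ _) _.
  by congr (_ - _); apply: free_actM.
case/orP=> [/eqP->|]; first by rewrite addE !(a0, a1, a2, a3) X2X1 addNr.
case/orP=> [/eqP->|]; first by rewrite addE !(a0, a1, a2, a3) Y2Y1 addNr.
case/orP=> [/eqP->|]; first by rewrite subE !(a0, a1, a2, a3) Y1X1 subrr.
case/orP=> [/eqP->|]; first by rewrite subE !(a0, a1, a2, a3) Y1X2 subrr.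
case/orP=> [/eqP->|]; first by rewrite subE !(a0, a1, a2, a3) Y2X1 subrr.
move/eqP->; apply: etrans (free_actB _ _ _) _; rewrite free_actM.
apply: etrans (congr1 _ (congr1 _ (free_actZ _ _ _))) _; rewrite free_actM.
by rewrite !(a0, a1, a2, a3) Y2X2 subrr.
Qed.

(** Makes the action of the free algebra factor through B. *)
Lemma free_act_ideal f v : f \in BK_ideal alpha -> free_act v f = 0.
Proof.
move=> /two_sided_idealP[s /allP s_rel ->]; rewrite linear_sum big_seq big1 //.
by move=> t /s_rel t_rel /=; rewrite 2!free_actM (free_act_relator _ t_rel) free_act0.
Qed.

Local Notation B := (BK alpha).

(** Applying an element of B to the empty monomial reads off its coefficients on
    the ordered monomials. *)
Definition BKcoord (b : B) : V := free_act (mon 0 0 0 0) (BKlift b).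

Lemma BKcoord_toBK f : BKcoord (toBK alpha f) = free_act (mon 0 0 0 0) f.
Proof.
by apply/esym/eqP; rewrite -subr_eq0 -free_actB free_act_ideal ?BKlift_toBK.
Qed.

Lemma BKcoord_is_linear : linear BKcoord.
Proof.
move=> c a b; rewrite -[a]BKliftK -[b]BKliftK -toBKZ -toBKD !BKcoord_toBK.
exact: linearP.
Qed.
HB.instance Definition _ :=
  GRing.isLinear.Build k B V *:%R BKcoord BKcoord_is_linear.

Lemma BKcoordM f b : BKcoord (toBK alpha f * b) = free_act (BKcoord b) f.
Proof. by rewrite -[b]BKliftK -toBKM !BKcoord_toBK free_actM. Qed.

Local Notation x1 := (BKx1 alpha).
Local Notation x2 := (BKx2 alpha).
Local Notation y1 := (BKy1 alpha).
Local Notation y2 := (BKy2 alpha).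

Lemma BKcoord_x1 b : BKcoord (x1 * b) = X1 (BKcoord b).
Proof. by rewrite BKcoordM free_act_letter. Qed.
Lemma BKcoord_x2 b : BKcoord (x2 * b) = X2 (BKcoord b).
Proof. by rewrite BKcoordM free_act_letter. Qed.
Lemma BKcoord_y1 b : BKcoord (y1 * b) = Y1 (BKcoord b).
Proof. by rewrite BKcoordM free_act_letter. Qed.
Lemma BKcoord_y2 b : BKcoord (y2 * b) = Y2 (BKcoord b).
Proof. by rewrite BKcoordM free_act_letter. Qed.

Local Notation pbw_eval := (pbw_eval x1 x2 y1 y2).

(** An ordered monomial, applied to the empty monomial, rebuilds itself without
    any reordering; so ordered monomials are linearly independent in B. *)
Lemma pbw_evalK : cancel pbw_eval BKcoord.
Proof.
have coordXn (g : B) (G : V -> V) : (forall b, BKcoord (g * b) = G (BKcoord b)) ->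
    forall n b, BKcoord (g ^+ n * b) = iter n G (BKcoord b).
  by move=> gG n b; elim: n => [|n IHn]; rewrite ?mul1r // exprS -mulrA gG IHn.
apply: (mon_ext (f := BKcoord \o pbw_eval) (g := idfun)) => a b c d /=.
rewrite pbw_evalE -!mulrA (coordXn _ _ BKcoord_x1) (coordXn _ _ BKcoord_x2).
rewrite (coordXn _ _ BKcoord_y1) -[y2 ^+ d]mulr1 (coordXn _ _ BKcoord_y2).
have -> : BKcoord 1 = mon 0 0 0 0.
  rewrite -[1]/(toBK alpha 1) BKcoord_toBK.
  by apply: etrans (linear_extensionU _ mone) _; rewrite /word_act fm1.
have -> : iter d Y2 (mon 0 0 0 0) = mon 0 0 0 d.
  by elim: d => //= d ->; rewrite Y2E !scale1r.
have -> : iter c Y1 (mon 0 0 0 d) = mon 0 0 c d.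
  by elim: c => //= c ->; rewrite Y1E !scale1r.
have -> : iter b X2 (mon 0 0 c d) = mon 0 b c d.
  by elim: b => //= b ->; rewrite X2E !scale1r.
by elim: a => //= a ->; rewrite X1E.
Qed.

Lemma toBK_rel i : (i < 6)%N -> toBK alpha (BK_relators alpha)`_i = 0.
Proof. by move=> i6; apply: toBK_relator; apply: mem_nth. Qed.

Lemma toBK_skew f g f' g' : toBK alpha (f * g + f' * g') = 0 ->
  toBK alpha f * toBK alpha g = - (toBK alpha f' * toBK alpha g').
Proof.
move=> rel; apply/eqP; rewrite -addr_eq0; apply/eqP.
by rewrite -2!toBKM -toBKD.
Qed.

Lemma toBK_swap f g f' g' : toBK alpha (f * g - f' * g') = 0 ->
  toBK alpha f * toBK alpha g = toBK alpha f' * toBK alpha g'.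
Proof.
move=> rel; apply/eqP; rewrite -subr_eq0; apply/eqP.
by rewrite -2!toBKM -toBKN -toBKD.
Qed.

Lemma BK_x2x1 : x2 * x1 = - (x1 * x2).
Proof. exact: toBK_skew (toBK_rel (i := 0) isT). Qed.
Lemma BK_y2y1 : y2 * y1 = - (y1 * y2).
Proof. exact: toBK_skew (toBK_rel (i := 1) isT). Qed.
Lemma BK_y1x1 : y1 * x1 = x1 * y1.
Proof. exact: toBK_swap (toBK_rel (i := 2) isT). Qed.
Lemma BK_y1x2 : y1 * x2 = x2 * y2.
Proof. exact: toBK_swap (toBK_rel (i := 3) isT). Qed.
Lemma BK_y2x1 : y2 * x1 = x1 * y2.
Proof. exact: toBK_swap (toBK_rel (i := 4) isT). Qed.
Lemma BK_y2x2 : y2 * x2 = alpha *: (x2 * y1).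
Proof.
apply/eqP; rewrite -subr_eq0; apply/eqP.
apply: etrans (toBK_rel (i := 5) isT).
by rewrite -2!toBKM -toBKZ -toBKN -toBKD.
Qed.


Lemma letter_cons i (s : seq 'I_4) :
  << FMonom (i :: s) >> = letter k i * << FMonom s >> :> freealg k.
Proof.
rewrite malgM_def /letter inord_val fgmulUU mulr1; congr << _ *g _ >>.
by apply/eqP; rewrite fmP fmM fmuE.
Qed.

Lemma pbw_eval_letter (i : 'I_4) v :
  pbw_eval (letter_op i v) = nth x1 [:: x1; x2; y1; y2] i * pbw_eval v.
Proof.
case: i => -[|[|[|[|//]]]] i4.
- exact: pbw_eval_X1.
- exact: (pbw_eval_X2 _ _ BK_x2x1).
- exact: (pbw_eval_Y1 BK_y2y1 BK_y1x1 BK_y1x2 BK_y2x2).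
- exact: (pbw_eval_Y2 BK_y2y1 BK_y1x2 BK_y2x1 BK_y2x2).
Qed.

Lemma toBK_letter (i : 'I_4) :
  toBK alpha (letter k i) = nth x1 [:: x1; x2; y1; y2] i.
Proof. by case: i => -[|[|[|[|//]]]] i4. Qed.

Lemma pbw_eval_word (s : seq 'I_4) v :
  pbw_eval (word_act s v) = toBK alpha << FMonom s >> * pbw_eval v.
Proof.
elim: s => [|i s IHs].
  by rewrite -fmoneE mul1r.
rewrite letter_cons toBKM -mulrA -IHs toBK_letter.
exact: pbw_eval_letter.
Qed.

(** Evaluation is a map of modules. Applied to the empty monomial, this shows
    that ordered monomials span B. *)
Lemma pbw_eval_act f v : pbw_eval (free_act v f) = toBK alpha f * pbw_eval v.
Proof.
apply: (linear_ext (f := pbw_eval \o free_act v) (g := pbw_eval v \o* toBK alpha)) => w.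
by rewrite /= /free_act linear_extensionU -[w in RHS]fmK -pbw_eval_word.
Qed.

Lemma BKcoordK : cancel BKcoord pbw_eval.
Proof.
move=> b; rewrite -[b in RHS]BKliftK /BKcoord pbw_eval_act pbw_evalE.
by rewrite !mulr1.
Qed.

End Coordinates.

(** * Dividing by the generators *)

Section Division.
Variables (k : fieldType) (alpha : k).
Local Notation V := {malg k[pbw_index]}.
Implicit Types (u v : V).
Local Notation mon := (@mon k).
Local Notation X1 := (@X1 k).
Local Notation X2 := (@X2 k).
Local Notation Y1 := (@Y1 k alpha).
Local Notation Y2 := (@Y2 k alpha).

(** Partial inverses of the four operators, and the projection onto the monomials
    free of x1 and x2. The maps [divY1] and [divY2] undo [Y1] and [Y2] only on those
    monomials, where the exponent of x2 is 0 and no power of alpha occurs. *)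
Definition divX1 : V -> V :=
  on_mon (fun a b c d => if a is a'.+1 then mon a' b c d else 0).
Definition divX2 : V -> V :=
  on_mon (fun a b c d => if b is b'.+1 then (-1) ^+ a *: mon a b' c d else 0).
Definition xfree : V -> V :=
  on_mon (fun a b c d => if (a + b == 0)%N then mon 0 0 c d else 0).
Definition divY1 : V -> V :=
  on_mon (fun a b c d => if c is c'.+1 then mon a b c' d else 0).
Definition divY2 : V -> V :=
  on_mon (fun a b c d => if d is d'.+1 then (-1) ^+ c *: mon a b c d' else 0).

HB.instance Definition _ := GRing.Linear.on divX1.
HB.instance Definition _ := GRing.Linear.on divX2.
HB.instance Definition _ := GRing.Linear.on xfree.
HB.instance Definition _ := GRing.Linear.on divY1.
HB.instance Definition _ := GRing.Linear.on divY2.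

Lemma divX1E a b c d : divX1 (mon a b c d) = if a is a'.+1 then mon a' b c d else 0.
Proof. exact: on_monE. Qed.
Lemma divX2E a b c d :
  divX2 (mon a b c d) = if b is b'.+1 then (-1) ^+ a *: mon a b' c d else 0.
Proof. exact: on_monE. Qed.
Lemma xfreeE a b c d :
  xfree (mon a b c d) = if (a + b == 0)%N then mon 0 0 c d else 0.
Proof. exact: on_monE. Qed.
Lemma divY1E a b c d : divY1 (mon a b c d) = if c is c'.+1 then mon a b c' d else 0.
Proof. exact: on_monE. Qed.
Lemma divY2E a b c d :
  divY2 (mon a b c d) = if d is d'.+1 then (-1) ^+ c *: mon a b c d' else 0.
Proof. exact: on_monE. Qed.
Definition divE := (divX1E, divX2E, xfreeE, divY1E, divY2E).

Let sign2 n : (-1) ^+ n * (-1) ^+ n = 1 :> k.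
Proof. by rewrite -exprMn mulrNN mul1r expr1n. Qed.

Lemma X1K : cancel X1 divX1.
Proof.
apply: (mon_ext (f := divX1 \o X1) (g := idfun)) => a b c d /=.
by rewrite opE divE.
Qed.

Lemma X2K : cancel X2 divX2.
Proof.
apply: (mon_ext (f := divX2 \o X2) (g := idfun)) => a b c d /=.
by rewrite opE linearZ /= divE scalerA sign2 scale1r.
Qed.

Lemma divX1X2 v : divX1 (X2 v) = - X2 (divX1 v).
Proof.
apply: (mon_ext (f := divX1 \o X2) (g := \- (X2 \o divX1))) v => a b c d /=.
rewrite opE linearZ /= !divE; case: a => [|a]; first by rewrite ?linear0 ?oppr0 ?scaler0.
by rewrite opE exprS mulN1r scaleNr.
Qed.

(** Division with remainder by x1, then by x2: the kernel of [xfree] is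
    the span of the monomials that contain an x. *)
Lemma xfree_split v : v = X1 (divX1 v) + X2 (divX2 (v - X1 (divX1 v))) + xfree v.
Proof.
apply: (mon_ext (f := idfun)
  (g := (X1 \o divX1) \+ (X2 \o (divX2 \o (idfun \- (X1 \o divX1)))) \+ xfree)) v.
move=> a b c d /=; rewrite !divE; case: a => [|a].
  rewrite linear0 subr0 add0r divE; case: b => [|b].
    by rewrite linear0 add0r.
  by rewrite linearZ /= opE scalerA sign2 scale1r addr0.
by rewrite opE subrr !linear0 !addr0.
Qed.

Lemma xfreeX1 v : xfree (X1 v) = 0.
Proof.
apply: (mon_ext (f := xfree \o X1) (g := \0)) v => a b c d /=.
by rewrite opE divE.
Qed.

Lemma xfreeX2 v : xfree (X2 v) = 0.
Proof.
apply: (mon_ext (f := xfree \o X2) (g := \0)) v => a b c d /=.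
by rewrite opE linearZ /= divE addnS scaler0.
Qed.

Lemma xfreeY1 v : xfree (Y1 v) = Y1 (xfree v).
Proof.
apply: (mon_ext (f := xfree \o Y1) (g := Y1 \o xfree)) v => a b c d /=.
rewrite opE linearZ /= divE; case: a b => [|a] [|b] /=.
- by rewrite divE opE.
- by case: odd; rewrite ?linearZ /= divE ?linear0 ?scaler0.
- by rewrite divE ?linear0 ?scaler0.
- by case: odd; rewrite ?linearZ /= divE ?linear0 ?scaler0.
Qed.

Lemma xfreeY2 v : xfree (Y2 v) = Y2 (xfree v).
Proof.
apply: (mon_ext (f := xfree \o Y2) (g := Y2 \o xfree)) v => a b c d /=.
rewrite opE linearZ /= divE; case: a b => [|a] [|b] /=.
- by rewrite linearZ /= divE opE.
- by case: odd; rewrite ?linearZ /= divE ?linear0 ?scaler0.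
- by rewrite linearZ /= divE ?linear0 ?scaler0.
- by case: odd; rewrite ?linearZ /= divE ?linear0 ?scaler0.
Qed.

Lemma xfree_divY1 v : xfree (divY1 (xfree v)) = divY1 (xfree v).
Proof.
apply: (mon_ext (f := xfree \o (divY1 \o xfree)) (g := divY1 \o xfree)) v => a b c d /=.
rewrite divE; case: ifP => ab; rewrite ?linear0 ?divE //.
by case: c => [|c]; rewrite ?linear0 ?divE.
Qed.

Lemma divY1Y1 v : divY1 (Y1 (xfree v)) = xfree v.
Proof.
apply: (mon_ext (f := divY1 \o (Y1 \o xfree)) (g := xfree)) v => a b c d /=.
rewrite divE; case: ifP => ab; rewrite ?linear0 //.
by rewrite opE /= scale1r divE.
Qed.

Lemma divY2Y2 v : divY2 (Y2 (xfree v)) = xfree v.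
Proof.
apply: (mon_ext (f := divY2 \o (Y2 \o xfree)) (g := xfree)) v => a b c d /=.
rewrite divE; case: ifP => ab; rewrite ?linear0 //.
by rewrite opE /= scale1r linearZ /= divE scalerA sign2 scale1r.
Qed.

Lemma divY1Y2 v : divY1 (Y2 (xfree v)) = - Y2 (divY1 (xfree v)).
Proof.
apply: (mon_ext (f := divY1 \o (Y2 \o xfree)) (g := \- (Y2 \o (divY1 \o xfree)))) v.
move=> a b c d /=; rewrite divE; case: ifP => ab; rewrite ?linear0 ?oppr0 //.
rewrite opE /= scale1r linearZ /= !divE; case: c => [|c].
  by rewrite ?linear0 ?oppr0.
by rewrite opE scale1r exprS mulN1r scaleNr.
Qed.

(** The division by x1 of the second coordinate is the syzygy: [divX1] and [X2]
    commute up to sign because [X1] and [X2] do. *)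
Lemma X_syzygy u v : X1 u + X2 v = 0 -> u = X2 (divX1 v) /\ v = X1 (divX1 v).
Proof.
move=> uv0; have X1u : X1 u = - X2 v by apply/eqP; rewrite -addr_eq0 uv0.
have uE : u = X2 (divX1 v) by rewrite -[LHS]X1K X1u linearN /= divX1X2 opprK.
split=> //; apply: (can_inj X2K).
by rewrite X2X1 -uE X1u opprK.
Qed.

Lemma xfree_eq0 v : xfree v = 0 -> exists p q, v = X1 p + X2 q.
Proof.
move=> v0; exists (divX1 v), (divX2 (v - X1 (divX1 v))).
by rewrite {1}[v]xfree_split v0 addr0.
Qed.

Lemma Y1_xfree v : xfree (Y1 v) = 0 -> xfree v = 0.
Proof. by rewrite xfreeY1 => Yv0; rewrite -divY1Y1 Yv0 linear0. Qed.

(** The same argument as for x1 and x2, after projecting to the monomials in y1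
    and y2, on which [Y1] and [Y2] again commute up to sign. *)
Lemma Y_syzygy u v : xfree (Y1 u + Y2 v) = 0 ->
  exists e, xfree (u - Y2 e) = 0 /\ xfree (v - Y1 e) = 0.
Proof.
rewrite linearD /= xfreeY1 xfreeY2 => uv0.
pose e := divY1 (xfree v); exists e.
have eE : xfree e = e by apply: xfree_divY1.
have uE : xfree u = Y2 e.
  rewrite -divY1Y1 (_ : Y1 (xfree u) = - Y2 (xfree v)) ?linearN /= ?divY1Y2 ?opprK //.
  by apply/eqP; rewrite -addr_eq0; apply/eqP.
split; first by rewrite linearB /= xfreeY2 eE uE subrr.
have vE : Y2 (xfree v - Y1 e) = 0.
  by rewrite linearB /= Y2Y1 opprK -uE addrC.
rewrite linearB /= xfreeY1 eE.
have -> : xfree v - Y1 e = xfree (v - Y1 e) by rewrite linearB /= xfreeY1 eE.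
rewrite -divY2Y2 linearB /= xfreeY1 eE.
by rewrite vE linear0.
Qed.
End Division.

(** * Matrices given by their rows *)

Section RowMatrices.
Variable A : nzRingType.
Implicit Types (r s : seq A) (rows : seq (seq A)).

(** With columns and rows as lists, a product with explicit entries computes,
    and exactness becomes a statement about finitely many elements. *)
Fixpoint row_dot r s : A :=
  match r, s with a :: r', b :: s' => a * b + row_dot r' s' | _, _ => 0 end.

Definition rows_mx m n rows : 'M[A]_(m, n) :=
  \matrix_(i, j) (nth [::] rows i)`_j.
Definition seq_col n s : 'cV[A]_n := \col_i s`_i.

Lemma row_dotE n r s : size r = n -> size s = n ->
  row_dot r s = \sum_(i < n) r`_i * s`_i.
Proof.
elim: n r s => [|n IHn] [|a r] [|b s] //= => [_ _|[rn] [sn]].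
  by rewrite big_ord0.
by rewrite big_ord_recl (IHn r s).
Qed.

Definition row_sized n rows := all (fun r => size r == n) rows.

Lemma mul_rows_mx m n rows s : row_sized n rows -> size rows = m ->
  size s = n -> rows_mx m n rows *m seq_col n s =
  seq_col m [seq row_dot r s | r <- rows].
Proof.
move=> rows_n rows_m s_n; apply/matrixP => i j; rewrite !mxE.
have i_rows : (i < size rows)%N by rewrite rows_m.
rewrite (nth_map [::]) // (@row_dotE n) //; last first.
  by apply/eqP/(allP rows_n)/mem_nth.
by apply: eq_bigr => l _; rewrite !mxE.
Qed.

Lemma seq_col_inj n s t : size s = n -> size t = n ->
  seq_col n s = seq_col n t -> s = t.
Proof.
move=> s_n t_n /matrixP st; apply: (@eq_from_nth _ 0); rewrite s_n ?t_n //.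
by move=> i i_n; have := st (Ordinal i_n) 0; rewrite !mxE.
Qed.

Lemma seq_colP n (v : 'cV[A]_n) : exists2 s, size s = n & v = seq_col n s.
Proof.
exists [seq v i 0 | i <- enum 'I_n]; first by rewrite size_map size_enum_ord.
apply/matrixP => i j; rewrite ord1 mxE (nth_map i) ?size_enum_ord //.
by rewrite nth_ord_enum.
Qed.

Lemma seq_col0 n : seq_col n (nseq n 0) = 0.
Proof. by apply/matrixP => i j; rewrite !mxE nth_nseq; case: ifP. Qed.

(** Reduces exactness at a middle term to explicit systems of equations. *)
Lemma rows_mx_exact (m n p : nat) (P Q : seq (seq A)) :
  row_sized n P -> size P = m -> row_sized p Q -> size Q = n ->
  (forall w, size w = p ->
    [seq row_dot r [seq row_dot q w | q <- Q] | r <- P] = nseq m 0) ->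
  (forall s, size s = n -> [seq row_dot r s | r <- P] = nseq m 0 ->
    exists2 w, size w = p & s = [seq row_dot q w | q <- Q]) ->
  forall v : 'cV_n, rows_mx m n P *m v = 0 <->
    exists w : 'cV_p, v = rows_mx n p Q *m w.
Proof.
move=> P_n P_m Q_p Q_n PQ0 PQ v; split; last first.
  move=> [w ->]; have [t t_p ->] := seq_colP w.
  by rewrite mul_rows_mx // mul_rows_mx ?size_map // PQ0 // seq_col0.
have [s s_n ->] := seq_colP v; rewrite mul_rows_mx // -seq_col0.
move/seq_col_inj; rewrite size_map size_nseq => /(_ P_m erefl) /PQ.
by case=> // w w_p ->; exists (seq_col p w); rewrite mul_rows_mx.
Qed.

Definition in_right_ideal (g : seq A) (b : A) :=
  exists2 s, size s = size g & b = row_dot g s.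

Lemma in_right_ideal0 g : in_right_ideal g 0.
Proof.
exists (nseq (size g) 0); first by rewrite size_nseq.
by elim: g => //= a g <-; rewrite mulr0 addr0.
Qed.

Lemma in_right_idealD g a b :
  in_right_ideal g a -> in_right_ideal g b -> in_right_ideal g (a + b).
Proof.
move=> [s s_g ->] [t t_g ->].
exists [seq p.1 + p.2 | p <- zip s t].
  by rewrite size_map size_zip s_g t_g minnn.
elim: g s t s_g t_g => [|c g IHg] [|u s] [|v t] //= => [|[s_g] [t_g]].
  by rewrite addr0.
by rewrite mulrDr addrACA (IHg s t).
Qed.

Lemma in_right_idealM g i b : in_right_ideal g (g`_i * b).
Proof.
elim: g i => [|c g IHg] i; first by rewrite nth_nil mul0r; apply: in_right_ideal0.
case: i => [|i] /=.
  have [s s_g s0] := in_right_ideal0 g.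
  by exists (b :: s); rewrite /= ?s_g // -s0 addr0.
have [s s_g ->] := IHg i.
by exists (0 :: s); rewrite /= ?s_g // mulr0 add0r.
Qed.

End RowMatrices.

(** * Exactness of the complex from five facts about the generators *)

(** Proves t = 0 for a sum t whose terms cancel in pairs: the opposite of the
    first term is moved next to it, until nothing is left. *)
Ltac abelian_cancel :=
  rewrite ?(opprD, opprK, oppr0) -[LHS]addr0 -?addrA ?addKr ?addNKr;
  repeat (match goal with
  | |- @Algebra.add _ (@Algebra.opp _ ?x) _ = _ => rewrite (addrCA _ x)
  | |- @Algebra.add _ ?x _ = _ => rewrite (addrCA _ (- x)) end;
  rewrite ?addKr ?addNKr); reflexivity.

Section KoszulExactness.
Variables (k : fieldType) (alpha : k) (A : algType k) (x1 x2 y1 y2 : A).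
Hypotheses (x2x1 : x2 * x1 = - (x1 * x2)) (y2y1 : y2 * y1 = - (y1 * y2))
  (y1x1 : y1 * x1 = x1 * y1) (y1x2 : y1 * x2 = x2 * y2)
  (y2x1 : y2 * x1 = x1 * y2) (y2x2 : y2 * x2 = alpha *: (x2 * y1)).

Definition in_xA (b : A) := exists p q, b = x1 * p + x2 * q.

Hypotheses (x1_reg : forall b, x1 * b = 0 -> b = 0)
  (x2_reg : forall b, x2 * b = 0 -> b = 0)
  (x_syz : forall a b, x1 * a + x2 * b = 0 ->
     exists f, a = x2 * f /\ b = x1 * f)
  (y1_reg : forall c, in_xA (y1 * c) -> in_xA c)
  (y_syz : forall c d, in_xA (y1 * c + y2 * d) ->
     exists e, in_xA (c - y2 * e) /\ in_xA (d - y1 * e)).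

Definition rows1 := [:: [:: x1; x2; y1; y2]].

Definition rows2 :=
  [:: [:: x2;  0; - y1;    0; - y2;               0];
      [:: x1;  0;    0; - y2;    0; - (alpha *: y1)];
      [::  0; y2;   x1;   x2;    0;               0];
      [::  0; y1;    0;    0;   x1;              x2]].

Definition rows3 :=
  [:: [:: y2; alpha *: y1;    0;               0];
      [::  0;           0;   x1;              x2];
      [:: x2;           0; - y2;               0];
      [:: x1;           0;    0; - (alpha *: y1)];
      [::  0;          x2; - y1;               0];
      [::  0;          x1;    0;            - y2]].

Definition rows4 := [:: [:: alpha *: y1]; [:: y2]; [:: x2]; [:: x1]].

Let simp := (mul0r, mulNr, add0r, addr0).

Let scaleMl c (a b : A) : c *: a * b = c *: (a * b).
Proof. by rewrite scalerAl. Qed.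
Let scaleMr c (a b : A) : a * (c *: b) = c *: (a * b).
Proof. by rewrite scalerAr. Qed.

(* Distributes, and moves the x's to the left of the y's in the coefficients of
   the unknowns. *)
Let normal := (@mulrDr A, @mulrN A, @mulNr A, @mulrA A, @opprD A, @opprK A,
  @scalerN k A, @scalerDr k A, scaleMl, scaleMr,
  x2x1, y2y1, y1x1, y1x2, y2x1, y2x2).

(** A cycle (a, b, c, d) gives a syzygy (c, d) of y1 and y2 modulo x1 A + x2 A;
    [y_syz] writes c and d through a boundary. What remains is a syzygy of x1
    and x2, treated by [x_syz]. *)
Lemma exact12 (v : 'cV_4) :
  rows_mx 1 4 rows1 *m v = 0 <-> exists w : 'cV_6, v = rows_mx 4 6 rows2 *m w.
Proof.
apply: rows_mx_exact => // [[|f [|e [|p [|q [|r [|s [|//]]]]]]] // _|].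
  by rewrite /= !simp; congr [:: _]; rewrite !normal; abelian_cancel.
case=> [|a [|b [|c [|d [|//]]]]] // _ [].
rewrite /= addr0 => abcd0.
have [|e [[p [q cE]] [r [s dE]]]] := y_syz (c := c) (d := d).
  exists (- a), (- b); apply: subr0_eq; rewrite -[RHS]abcd0 !normal.
  by apply: subr0_eq; abelian_cancel.
have {}cE : c = x1 * p + x2 * q + y2 * e by rewrite -cE subrK.
have {}dE : d = x1 * r + x2 * s + y1 * e by rewrite -dE subrK.
have [|f [aE bE]] := x_syz (a := a + y1 * p + y2 * r)
    (b := b + y2 * q + alpha *: (y1 * s)).
  by rewrite -abcd0 cE dE !normal; apply: subr0_eq; abelian_cancel.
exists [:: f; e; p; q; r; s] => //=; rewrite !simp.
congr [:: _; _; _; _]; apply: subr0_eq; rewrite ?cE ?dE -?aE -?bE ?normal;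
  by abelian_cancel.
Qed.

(** The last row puts y1 v2 in x1 A + x2 A, hence v2 = x1 p + x2 q by [y1_reg]. The
    last two rows then are syzygies of x1 and x2, which determine v3, v4, v5 and v6;
    the first row fixes v1 because x2 is regular. *)
Lemma exact23 (v : 'cV_6) :
  rows_mx 4 6 rows2 *m v = 0 <-> exists w : 'cV_4, v = rows_mx 6 4 rows3 *m w.
Proof.
apply: rows_mx_exact => // [[|f [|g [|p [|q [|//]]]]] // _|].
  by rewrite /= !simp; congr [:: _; _; _; _]; rewrite !normal; abelian_cancel.
case=> [|v1 [|v2 [|v3 [|v4 [|v5 [|v6 [|//]]]]]]] // _ [].
rewrite /= !simp => row1 row2 row3 row4.
have [|p [q v2E]] := y1_reg (c := v2).
  exists (- v5), (- v6); apply: subr0_eq; rewrite -[RHS]row4 !normal.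
  by apply: subr0_eq; abelian_cancel.
have [|f [v3E v4E]] := x_syz (a := v3 + y2 * p) (b := v4 + alpha *: (y1 * q)).
  by rewrite -row3 v2E !normal; apply: subr0_eq; abelian_cancel.
have [|g [v5E v6E]] := x_syz (a := v5 + y1 * p) (b := v6 + y2 * q).
  by rewrite -row4 v2E !normal; apply: subr0_eq; abelian_cancel.
have v1E : v1 = y2 * f + alpha *: (y1 * g).
  apply/eqP; rewrite -subr_eq0; apply/eqP/x2_reg; rewrite -row1.
  have -> : v3 = x2 * f - y2 * p by rewrite -v3E addrK.
  have -> : v5 = x2 * g - y1 * p by rewrite -v5E addrK.
  by rewrite !normal; apply: subr0_eq; abelian_cancel.
exists [:: f; g; p; q] => //=; rewrite !simp.
congr [:: _; _; _; _; _; _]; apply: subr0_eq;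
  by rewrite ?v1E ?v2E -?v3E -?v4E -?v5E -?v6E ?normal; abelian_cancel.
Qed.

(** The second row is a syzygy of x1 and x2 between v3 and v4, with a quotient f;
    the rows starting with x2 then force v1 and v2. *)
Lemma exact34 (v : 'cV_4) :
  rows_mx 6 4 rows3 *m v = 0 <-> exists w : 'cV_1, v = rows_mx 4 1 rows4 *m w.
Proof.
apply: rows_mx_exact => // [[|f [|//]] // _|].
  by rewrite /= !simp; congr [:: _; _; _; _; _; _]; rewrite !normal; abelian_cancel.
case=> [|v1 [|v2 [|v3 [|v4 [|//]]]]] // _ [].
rewrite /= !simp => _ /x_syz[f [v3E v4E]] row3 _ row5 _.
exists [:: f] => //=; rewrite !simp v3E v4E.
congr [:: _; _; _; _].
  apply/eqP; rewrite -subr_eq0; apply/eqP/x2_reg; rewrite -row3 v3E !normal.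
  by apply: subr0_eq; abelian_cancel.
apply/eqP; rewrite -subr_eq0; apply/eqP/x2_reg; rewrite -row5 v3E !normal.
by apply: subr0_eq; abelian_cancel.
Qed.

Lemma exact4 (v : 'cV_1) : rows_mx 4 1 rows4 *m v = 0 -> v = 0.
Proof.
have [[|f [|//]] // _ ->] := seq_colP v.
rewrite mul_rows_mx // -seq_col0 => /seq_col_inj; rewrite /= => /(_ erefl erefl) [].
rewrite !simp => _ _ _ /x1_reg ->; exact: (seq_col0 _ 1).
Qed.
End KoszulExactness.

(** * The five facts for the algebra B *)

Section Transfer.
Variables (k : fieldType) (alpha : k).
Local Notation V := {malg k[pbw_index]}.
Local Notation B := (BK alpha).
Implicit Types (v : V) (a b c d : B).
Local Notation x1 := (BKx1 alpha).
Local Notation x2 := (BKx2 alpha).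
Local Notation y1 := (BKy1 alpha).
Local Notation y2 := (BKy2 alpha).
Local Notation pbw_eval := (pbw_eval x1 x2 y1 y2).
Local Notation coord := (@BKcoord k alpha).

Lemma pbw_eval_x1 v : pbw_eval (X1 v) = x1 * pbw_eval v.
Proof. exact: pbw_eval_X1. Qed.
Lemma pbw_eval_x2 v : pbw_eval (X2 v) = x2 * pbw_eval v.
Proof. exact: (pbw_eval_X2 _ _ (BK_x2x1 _)). Qed.
Lemma BKcoord_eq0 b : coord b = 0 -> b = 0.
Proof. by move=> b0; rewrite -[b]BKcoordK b0 linear0. Qed.

Lemma BK_x1_reg b : x1 * b = 0 -> b = 0.
Proof.
move=> xb0; apply: BKcoord_eq0; rewrite -[LHS]X1K -BKcoord_x1 xb0.
by rewrite linear0 linear0.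
Qed.

Lemma BK_x2_reg b : x2 * b = 0 -> b = 0.
Proof.
move=> xb0; apply: BKcoord_eq0; rewrite -[LHS]X2K -BKcoord_x2 xb0.
by rewrite linear0 linear0.
Qed.

Lemma BKcoord_x a b : coord (x1 * a + x2 * b) = X1 (coord a) + X2 (coord b).
Proof.
by apply: etrans (linearD _ _ _) (congr2 +%R (BKcoord_x1 _) (BKcoord_x2 _)).
Qed.

Lemma BKcoord_y a b :
  coord (y1 * a + y2 * b) = Y1 alpha (coord a) + Y2 alpha (coord b).
Proof.
by apply: etrans (linearD _ _ _) (congr2 +%R (BKcoord_y1 _) (BKcoord_y2 _)).
Qed.

Lemma BK_x_syz a b : x1 * a + x2 * b = 0 ->
  exists f, a = x2 * f /\ b = x1 * f.
Proof.
move/(congr1 coord); rewrite BKcoord_x linear0.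
case/X_syzygy => aE bE; exists (pbw_eval (divX1 (coord b))).
by rewrite -pbw_eval_x1 -pbw_eval_x2 -aE -bE !BKcoordK.
Qed.

Lemma in_xAP b : in_xA x1 x2 b <-> xfree (coord b) = 0.
Proof.
split=> [[p [q ->]]|/xfree_eq0[p [q pq]]].
  by rewrite BKcoord_x linearD /= xfreeX1 xfreeX2 addr0.
exists (pbw_eval p), (pbw_eval q).
by rewrite -[b]BKcoordK pq linearD /= pbw_eval_x1 pbw_eval_x2.
Qed.

Lemma BK_y1_reg c : in_xA x1 x2 (y1 * c) -> in_xA x1 x2 c.
Proof. by move/in_xAP; rewrite BKcoord_y1 => /Y1_xfree/in_xAP. Qed.

Lemma BK_y_syz c d : in_xA x1 x2 (y1 * c + y2 * d) ->
  exists e, in_xA x1 x2 (c - y2 * e) /\ in_xA x1 x2 (d - y1 * e).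
Proof.
move/in_xAP; rewrite BKcoord_y => /Y_syzygy[e [ce de]].
exists (pbw_eval e); split; apply/in_xAP.
  apply: etrans ce; congr (xfree _); apply: etrans (linearB _ _ _) _.
  congr (_ - _); exact: etrans (BKcoord_y2 _) (congr1 _ (pbw_evalK _ _)).
apply: etrans de; congr (xfree _); apply: etrans (linearB _ _ _) _.
congr (_ - _); exact: etrans (BKcoord_y1 _) (congr1 _ (pbw_evalK _ _)).
Qed.

Lemma BK_aug_x1 : BK_aug x1 = 0.
Proof. by rewrite BK_aug_toBK mcoeff1_letter. Qed.
Lemma BK_aug_x2 : BK_aug x2 = 0.
Proof. by rewrite BK_aug_toBK mcoeff1_letter. Qed.
Lemma BK_aug_y1 : BK_aug y1 = 0.
Proof. by rewrite BK_aug_toBK mcoeff1_letter. Qed.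
Lemma BK_aug_y2 : BK_aug y2 = 0.
Proof. by rewrite BK_aug_toBK mcoeff1_letter. Qed.

(** Every nonempty word starts with a letter. *)
Lemma BK_aug_gens b : BK_aug b = 0 -> in_right_ideal [:: x1; x2; y1; y2] b.
Proof.
rewrite -[b]BKliftK BK_aug_toBK; move: (BKlift b) => f f0.
rewrite [f]malg_sum linear_sum big_seq; apply: big_ind => [|g h|w w_f].
- exact: in_right_ideal0.
- exact: in_right_idealD.
rewrite linearZ_LR /=.
case: w w_f => -[|i s] w_f.
  by move: w_f; rewrite -mcoeff_neq0 -fmoneE f0 eqxx.
rewrite letter_cons toBKM toBK_letter scalerAr.
rewrite (set_nth_default 0) //; exact: in_right_idealM.
Qed.

End Transfer.

(** * Homogeneous components *)

Section Homogeneous.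
Variables (k : fieldType) (alpha : k).
Local Notation V := {malg k[pbw_index]}.
Local Notation B := (BK alpha).
Implicit Types (v : V) (a b c : B) (d e : int).
Local Notation x1 := (BKx1 alpha).
Local Notation x2 := (BKx2 alpha).
Local Notation y1 := (BKy1 alpha).
Local Notation y2 := (BKy2 alpha).
Local Notation pbw_eval := (pbw_eval x1 x2 y1 y2).
Local Notation coord := (@BKcoord k alpha).
Local Notation mon := (@mon k).

Lemma BK_homog0 d : BK_homog d (0 : B).
Proof. by exists 0; rewrite ?linear0 // => m; rewrite msupp0. Qed.

Lemma BK_homogD d a b : BK_homog d a -> BK_homog d b -> BK_homog d (a + b).
Proof.
move=> [f f_d ->] [g g_d ->]; exists (f + g); last by rewrite linearD.
move=> m /(fsubsetP (msuppD_le f g)); rewrite in_fsetU.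
by case/orP; [apply: f_d | apply: g_d].
Qed.

Lemma BK_homogZ d (z : k) a : BK_homog d a -> BK_homog d (z *: a).
Proof.
move=> [f f_d ->]; exists (z *: f); last by rewrite linearZ_LR.
by move=> m /(fsubsetP (msuppZ_le z f)); apply: f_d.
Qed.

Lemma BK_homogN d a : BK_homog d a -> BK_homog d (- a).
Proof. by rewrite -scaleN1r; apply: BK_homogZ. Qed.

Lemma BK_homogM d e a b :
  BK_homog d a -> BK_homog e b -> BK_homog (d + e) (a * b).
Proof.
move=> [f f_d ->] [g g_e ->]; exists (f * g); last by rewrite toBKM.
move=> m /msuppM_le[m1 [m2 [/f_d <- /g_e <- ->]]].
by rewrite fdegM PoszD.
Qed.

Lemma BK_homog1 : BK_homog 0 (1 : B).
Proof.
exists 1 => // m; rewrite msuppC oner_eq0 in_fset1 => /eqP ->.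
by rewrite fdeg1.
Qed.

Lemma BK_homogX d a n : BK_homog d a -> BK_homog (d *+ n) (a ^+ n).
Proof.
move=> a_d; elim: n => [|n IHn]; first exact: BK_homog1.
by rewrite exprS mulrS; apply: BK_homogM.
Qed.

Lemma BK_homog_sum d (I : Type) (r : seq I) (P : pred I) (F : I -> B) :
  (forall i, P i -> BK_homog d (F i)) -> BK_homog d (\sum_(i <- r | P i) F i).
Proof.
by move=> F_d; apply: big_ind => //; [apply: BK_homog0 | apply: BK_homogD].
Qed.

Lemma BK_homog_letter i : BK_homog 1 (toBK alpha (letter k i)).
Proof.
by exists (letter k i) => // m; rewrite msuppU1 in_fset1 => /eqP ->; rewrite fdegU.
Qed.

Definition deg_part d : V -> V :=
  on_mon (fun a b c t : nat => if (a + b + c + t)%:Z == d then mon a b c t else 0).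
HB.instance Definition _ d := GRing.Linear.on (deg_part d).

Lemma deg_partE d (a b c t : nat) : deg_part d (mon a b c t) =
  if (a + b + c + t)%:Z == d then mon a b c t else 0.
Proof. exact: on_monE. Qed.

(** All four operators raise the total degree by one. *)
Lemma deg_part_letter (i : 'I_4) d v :
  deg_part (1 + d) (letter_op alpha i v) = letter_op alpha i (deg_part d v).
Proof.
apply: (mon_ext (f := deg_part (1 + d) \o letter_op alpha i)
  (g := letter_op alpha i \o deg_part d)) v.
have deg1 m n : (m = n.+1)%N -> (m%:Z == 1 + d) = (n%:Z == d).
  by move=> ->; rewrite -addn1 PoszD addrC (inj_eq (addrI _)).
move=> a b c t; rewrite /= deg_partE; case: i => -[|[|[|[|//]]]] i4; rewrite /letter_op /=.
- rewrite opE deg_partE (deg1 _ (a + b + c + t)%N); last by lia.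
  by case: eqP; rewrite ?linear0 ?opE.
- rewrite opE linearZ /= deg_partE (deg1 _ (a + b + c + t)%N); last by lia.
  by case: eqP; rewrite ?linear0 ?scaler0 ?opE.
- rewrite opE linearZ /=; case b_odd: (odd b).
    rewrite linearZ /= deg_partE (deg1 _ (a + b + c + t)%N); last by lia.
    by case: eqP; rewrite ?linear0 ?scaler0 ?opE ?b_odd.
  rewrite deg_partE (deg1 _ (a + b + c + t)%N); last by lia.
  by case: eqP; rewrite ?linear0 ?scaler0 ?opE ?b_odd.
- rewrite opE linearZ /=; case b_odd: (odd b).
    rewrite deg_partE (deg1 _ (a + b + c + t)%N); last by lia.
    by case: eqP; rewrite ?linear0 ?scaler0 ?opE ?b_odd.
  rewrite linearZ /= deg_partE (deg1 _ (a + b + c + t)%N); last by lia.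
  by case: eqP; rewrite ?linear0 ?scaler0 ?opE ?b_odd.
Qed.

Lemma deg_part_word (s : seq 'I_4) d v :
  deg_part ((size s)%:Z + d) (word_act alpha s v) = word_act alpha s (deg_part d v).
Proof.
elim: s d => [|i s IHs] d; first by rewrite add0r.
rewrite /= -IHs -deg_part_letter; congr (deg_part _ _).
by rewrite -addn1 PoszD [X in X + d]addrC -addrA.
Qed.

Lemma deg_part_act d e f v : (forall m, m \in msupp f -> (fdeg m)%:Z = d) ->
  deg_part (d + e) (free_act alpha v f) = free_act alpha (deg_part e v) f.
Proof.
move=> f_d; rewrite /free_act /linear_extension linear_sum big_seq [RHS]big_seq.
apply: eq_bigr => m /f_d <-; rewrite linearZ_LR /=.
by rewrite -deg_part_word.
Qed.

(** The homogeneous component of degree d, read off on ordered monomials; this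
    is well defined because the relations are homogeneous. *)
Definition hcomp d b : B := pbw_eval (deg_part d (coord b)).

Lemma hcomp_is_linear d : linear (hcomp d).
Proof. by move=> z a b; rewrite /hcomp !linearP. Qed.
HB.instance Definition _ d :=
  GRing.isLinear.Build k B B *:%R (hcomp d) (hcomp_is_linear d).

(** The property of components that makes lifting through a graded matrix
    possible in the right degree. *)
Lemma hcompM d e a b : BK_homog d a -> hcomp (d + e) (a * b) = a * hcomp e b.
Proof.
move=> [f f_d ->]; rewrite /hcomp BKcoordM deg_part_act //.
exact: pbw_eval_act.
Qed.

Lemma hcomp1 d : hcomp d 1 = if d == 0 then 1 else 0.
Proof.
have E : pbw_eval (mon 0 0 0 0) = 1 by rewrite pbw_evalE !mulr1.
have E' : coord 1 = mon 0 0 0 0 by rewrite -E pbw_evalK.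
rewrite /hcomp E' deg_partE eq_sym.
by case: eqP => _; rewrite ?E ?linear0.
Qed.

Lemma hcomp_homog_eq d e b :
  BK_homog d b -> hcomp e b = if e == d then b else 0.
Proof.
move=> b_d; rewrite -[b in LHS]mulr1 -{1}[e](subrK d) [e - d + d]addrC.
rewrite (hcompM _ _ b_d) hcomp1 subr_eq0.
by case: eqP; rewrite ?mulr1 ?mulr0.
Qed.

Lemma hcomp_homog d b : BK_homog d (hcomp d b).
Proof.
rewrite /hcomp; move: (coord b) => v; rewrite [v]malg_sum !linear_sum.
apply: BK_homog_sum => -[[[a1 b1] c1] t1] _; rewrite !linearZ_LR /=.
apply: BK_homogZ;
case: eqP => [<-|_]; last by rewrite linear0; apply: BK_homog0.
rewrite pbw_evalE !PoszD.
have h i n : BK_homog n%:Z (toBK alpha (letter k i) ^+ n).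
  by have := BK_homogX n (BK_homog_letter i); rewrite natz.
by do 3?apply: BK_homogM; apply: h.
Qed.

Definition hbound b : nat := \max_(t <- msupp (coord b))
  (let: (a, b, c, t) := t in (a + b + c + t).+1)%N.

Lemma hcomp_sum n b : (hbound b <= n)%N -> b = \sum_(i < n) hcomp i%:Z b.
Proof.
rewrite /hbound => b_n; rewrite -[LHS]BKcoordK /hcomp -!linear_sum; congr (pbw_eval _).
move: (coord b) b_n => v v_n.
under eq_bigr => i _ do rewrite {1}[v]malg_sum linear_sum.
rewrite [LHS]malg_sum exchange_big /= big_seq [RHS]big_seq.
apply: eq_bigr => -[[[a1 b1] c1] t1] t_v.
under eq_bigr => i _ do rewrite linearZ_LR /=.
rewrite -scaler_sumr; congr (_ *: _).
have lt_n : (a1 + b1 + c1 + t1 < n)%N.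
  apply: leq_trans v_n; rewrite (big_rem _ t_v) /=; exact: leq_maxl.
rewrite (bigD1 (Ordinal lt_n)) //= -[<< _ >>]/(mon a1 b1 c1 t1).
rewrite deg_partE eqxx big1 ?addr0 // => i i_n.
rewrite deg_partE; case: eqP => // -[it].
by case/eqP: i_n; apply/val_inj.
Qed.

End Homogeneous.

(** * Sequences built step by step *)

(** Chain maps and homotopies are built one degree after the other, in types that
    depend on the degree. *)
Lemma dependent_sequence (T : nat -> Type) (P : forall i, T i -> Prop)
    (R : forall i, T i -> T i.+1 -> Prop) (t0 : T 0%N) :
  P 0%N t0 -> (forall i t, P i t -> exists2 t', P i.+1 t' & R i t t') ->
  exists t : forall i, T i,
    [/\ t 0%N = t0, forall i, P i (t i) & forall i, R i (t i) (t i.+1)].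
Proof.
move=> P0 step.
pose next i (t : {t : T i | P i t}) := cid2 (step i (sval t) (svalP t)).
pose s i : {t : T i | P i t} := nat_rect (fun i => {t : T i | P i t})
  (exist _ t0 P0) (fun i t => exist _ (s2val (next i t)) (s2valP (next i t))) i.
exists (fun i => sval (s i)); split=> // i; first exact: svalP (s i).
exact: s2valP' (next i (s i)).
Qed.

(** * Comparing dimensions of quotients *)

Section DimensionBound.
Variables (k : fieldType) (U W : vectType k) (L : 'Hom(U, W)).

(** The hypotheses say that L induces an injective map from Z1 / B1 to Z2 / B2
    (on cosets of elements of Z1); subspaces are compared instead of quotients. *)
Lemma dim_quotient_le (Z1 B1 : {vspace U}) (Z2 B2 : {vspace W}) :
  (L @: Z1 <= Z2)%VS -> (B2 <= Z2)%VS ->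
  (forall z, z \in Z1 -> L z \in B2 -> z \in B1) ->
  (\dim Z1 - \dim B1 <= \dim Z2 - \dim B2)%N.
Proof.
move=> LZ BZ inj.
have cap_sub : (L @: Z1 :&: B2 <= L @: B1)%VS.
  apply/subvP => y; rewrite memv_cap => /andP[/memv_imgP[z z_Z ->]] Lz.
  by apply: memv_img; apply: inj.
have ker_sub : (Z1 :&: lker L <= B1 :&: lker L)%VS.
  rewrite subv_cap capvSr andbT; apply/subvP => z; rewrite memv_cap memv_ker.
  by case/andP => z_Z /eqP Lz; apply: inj => //; rewrite Lz mem0v.
have := dimvS ker_sub; have := dimvS cap_sub.
have : (\dim (L @: Z1 + B2) <= \dim Z2)%N by rewrite dimvS // subv_add LZ.
have := dimv_sum_cap (L @: Z1) B2; have := limg_ker_dim L Z1.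
have := limg_ker_dim L B1; lia.
Qed.
End DimensionBound.

(** * Graded matrices and graded lifting *)

Section GradedMatrices.
Variables (k : fieldType) (alpha : k).
Local Notation B := (BK alpha).

Definition mx_homog m n (dr : 'I_m -> int) (dc : 'I_n -> int)
    (M : 'M[B]_(m, n)) :=
  forall i j, BK_homog (dc j - dr i) (M i j).

Lemma mx_homogM m n p (dr : 'I_m -> int) (dm : 'I_n -> int) (dc : 'I_p -> int)
    (M : 'M[B]_(m, n)) (N : 'M[B]_(n, p)) :
  mx_homog dr dm M -> mx_homog dm dc N -> mx_homog dr dc (M *m N).
Proof.
move=> M_h N_h i j; rewrite mxE; apply: BK_homog_sum => l _.
by rewrite -(subrKA (dm l)) addrC; apply: BK_homogM.
Qed.

Lemma mx_homogB m n (dr : 'I_m -> int) (dc : 'I_n -> int) (M N : 'M[B]_(m, n)) :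
  mx_homog dr dc M -> mx_homog dr dc N -> mx_homog dr dc (M - N).
Proof.
by move=> M_h N_h i j; rewrite !mxE; apply: BK_homogD; last apply: BK_homogN.
Qed.

Lemma mx_homog1 n (d : 'I_n -> int) : mx_homog d d 1%:M.
Proof.
move=> i j; rewrite mxE; case: eqP => [->|_]; last exact: BK_homog0.
by rewrite subrr; apply: BK_homog1.
Qed.

Definition vcomp n (dv : 'I_n -> int) (d : int) (v : 'cV[B]_n) : 'cV[B]_n :=
  \col_l hcomp (d - dv l) (v l 0).

Lemma vcomp_homog n (dv : 'I_n -> int) d (v : 'cV[B]_n) l :
  BK_homog (d - dv l) (vcomp dv d v l 0).
Proof. by rewrite mxE; apply: hcomp_homog. Qed.

Lemma vcomp_id n (dv : 'I_n -> int) d (v : 'cV[B]_n) :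
  (forall l, BK_homog (d - dv l) (v l 0)) -> vcomp dv d v = v.
Proof.
move=> v_h; apply/matrixP => l j; rewrite ord1 mxE.
by rewrite (hcomp_homog_eq _ (v_h l)) eqxx.
Qed.

Lemma mul_vcomp m n (dr : 'I_m -> int) (dc : 'I_n -> int)
    (M : 'M[B]_(m, n)) d (v : 'cV[B]_n) :
  mx_homog dr dc M -> M *m vcomp dc d v = vcomp dr d (M *m v).
Proof.
move=> M_h; apply/matrixP => i j; rewrite ord1 !mxE linear_sum.
apply: eq_bigr => l _; rewrite mxE -(hcompM _ _ (M_h i l)).
by rewrite [_ + _]addrC subrKA.
Qed.

(** Each column lifts through D by hypothesis; its component in the degree of
    the column lifts it too, since multiplication by a graded matrix commutes
    with components. *)
Lemma lift_mx m n p (dr : 'I_m -> int) (dc : 'I_n -> int) (dp : 'I_p -> int)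
    (D : 'M[B]_(m, p)) (f : 'M[B]_(m, n)) :
  mx_homog dr dp D -> mx_homog dr dc f ->
  (forall w : 'cV[B]_n, exists u : 'cV[B]_p, f *m w = D *m u) ->
  exists2 g : 'M[B]_(p, n), mx_homog dp dc g & D *m g = f.
Proof.
move=> D_h f_h f_D.
have /choice[g_ gP] j : exists u : 'cV[B]_p,
    (forall l, BK_homog (dc j - dp l) (u l 0)) /\ D *m u = col j f.
  have [u uE] := f_D (delta_mx j 0); exists (vcomp dp (dc j) u).
  split=> [l|]; first exact: vcomp_homog.
  rewrite (mul_vcomp _ _ D_h) -uE -colE vcomp_id // => l.
  by rewrite mxE; apply: f_h.
exists (\matrix_(l, j) g_ j l 0) => [l j|]; first by rewrite mxE; apply: (gP j).1.
apply/matrixP => i j; have /matrixP/(_ i 0) := (gP j).2; rewrite !mxE => <-.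
by apply: eq_bigr => l _; rewrite mxE.
Qed.

Lemma BK_aug_homog d (b : B) : BK_homog d b -> d != 0 -> BK_aug b = 0.
Proof.
move=> [f f_d ->] d0; rewrite BK_aug_toBK; apply: mcoeff_outdom.
by apply/negP => /f_d; rewrite fdeg1 => /esym/eqP; rewrite (negPf d0).
Qed.

Lemma hcomp_sum_seq (s : seq int) (b : B) : uniq s ->
  (forall i, (i < hbound b)%N -> i%:Z \in s) -> \sum_(e <- s) hcomp e b = b.
Proof.
move=> s_uniq s_b; have bE := hcomp_sum (leqnn (hbound b)).
rewrite [RHS]bE; under eq_bigr => e _.
  rewrite {1}bE linear_sum; under eq_bigr => i _ do
    rewrite /= (hcomp_homog_eq _ (hcomp_homog i%:Z b)); over.
rewrite exchange_big; apply: eq_bigr => i _ /=.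
rewrite (bigD1_seq i%:Z) ?s_b //= eqxx big1 ?addr0 // => e.
by case: eqP.
Qed.

End GradedMatrices.

(** * Comparison of graded free resolutions *)

Section Comparison.
Variables (k : fieldType) (alpha : k).
Local Notation B := (BK alpha).
Implicit Types (F G : free_sequence alpha) (M : grmodule alpha).

Lemma mulmx_col_sum m n (f : 'M[B]_(m, n)) (v : 'cV[B]_n) :
  f *m v = \sum_j (v j 0 : B^c) *: (col j f : 'cV[B^c]_m) :> 'cV[B^c]_m.
Proof.
apply/matrixP => i j; rewrite ord1 summxE mxE.
by apply: eq_bigr => l _; rewrite !mxE.
Qed.

Definition augmentation F M := {linear 'cV[B^c]_(rk F 0) -> M}.

Lemma aug_mulmx F M (aug : augmentation F M) n (f : 'M[B]_(rk F 0, n))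
    (v : 'cV[B]_n) :
  aug (f *m v) = \sum_j (v j 0 : B^c) *: aug (col j f).
Proof.
rewrite (mulmx_col_sum f v) linear_sum; apply: eq_bigr => j _.
exact: linearZ_LR.
Qed.

Lemma free_homog_delta F i (j : 'I_(rk F i)) :
  free_homog (gen_deg j) (delta_mx j 0 : 'cV[B]_(rk F i)).
Proof.
move=> l; rewrite mxE eqxx andbT; case: eqP => [->|_]; last exact: BK_homog0.
by rewrite subrr; apply: BK_homog1.
Qed.

(** The images of the components of v have distinct degrees and add up to u,
    which has degree d; since the grading of M is direct, the component of
    degree d alone maps to u. *)
Lemma aug_vcomp F M (aug : augmentation F M) d (u : M) (v : 'cV[B]_(rk F 0)) :
  (forall e w, @free_homog k alpha F 0 e w -> grm_homog e (aug w)) ->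
  grm_homog d u -> aug v = u -> aug (vcomp (@gen_deg k alpha F 0) d v) = u.
Proof.
move=> aug_h u_d augv.
pose n := (\max_l hbound (v l ord0))%N.
pose s := undup (d :: [seq i%:Z + gen_deg l | i <- iota 0 n, l <- enum 'I_(rk F 0)]).
have vE : v = \sum_(e <- s) vcomp (@gen_deg k alpha F 0) e v.
  apply/matrixP => l j; rewrite ord1 summxE.
  under eq_bigr => e _ do rewrite mxE.
  rewrite -(big_map (fun e => e - gen_deg l) xpredT (fun e => hcomp e (v l 0))).
  rewrite hcomp_sum_seq // => [|i i_b].
    by rewrite map_inj_uniq ?undup_uniq //; apply: addIr.
  apply/mapP; exists (i%:Z + gen_deg l); last by rewrite addrK.
  rewrite mem_undup inE; apply/orP; right; apply/allpairsP.
  exists (i, l) => /=; split; rewrite ?mem_enum // mem_iota /= add0n.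
  by apply: leq_trans i_b _; apply: (leq_bigmax l).
pose c e := aug (vcomp (@gen_deg k alpha F 0) e v) - (if e == d then u else 0).
have c_h e : grm_homog e (c e).
  apply: grm_homogB; first by apply: aug_h => l; apply: vcomp_homog.
  by case: eqP => [->|_] //; apply: grm_homog0.
have s_d : d \in s by rewrite mem_undup mem_head.
have c0 : \sum_(e <- s) c e = 0.
  rewrite /c sumrB -linear_sum -vE augv (bigD1_seq d) ?undup_uniq //= eqxx.
  by rewrite big1 ?addr0 ?subrr // => e; case: eqP.
have := grm_direct (undup_uniq _) c_h c0 s_d; rewrite /c eqxx => /eqP.
by rewrite subr_eq0 => /eqP.
Qed.

Lemma diff_homog F M (aug : augmentation F M) : graded_free_resolution aug ->
  forall i, mx_homog (@gen_deg k alpha F i) (@gen_deg k alpha F i.+1) (diff F i).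
Proof.
case=> D_h _ _ _ _ i l j.
by have := D_h i _ _ (free_homog_delta j) l; rewrite -colE mxE.
Qed.

Lemma diff_diff F M (aug : augmentation F M) : graded_free_resolution aug ->
  forall i, diff F i *m diff F i.+1 = 0.
Proof.
case=> _ _ _ _ ex i; apply/matrixP => l j; rewrite [RHS]mxE.
have /ex/matrixP/(_ l 0) : exists w : 'cV_(rk F i.+2),
    diff F i.+1 *m delta_mx j 0 = diff F i.+1 *m w by exists (delta_mx j 0).
by rewrite mulmxA -colE !mxE.
Qed.

End Comparison.
Arguments diff_homog {k alpha F M aug} _ i.
Arguments diff_diff {k alpha F M aug} _ i.

Section TensorComparison.
Variables (k : fieldType) (alpha : k).
Local Notation B := (BK alpha).
Implicit Types (F G : free_sequence alpha) (M : grmodule alpha).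
Local Notation deg F i := (@gen_deg k alpha F i).

(** Freeness lets each step be lifted column by column; the invariant kept along
    the way is that f i sends boundaries to boundaries. *)
Lemma chain_map F G M (augF : augmentation F M) (augG : augmentation G M) :
  graded_free_resolution augF -> graded_free_resolution augG ->
  exists f : forall i, 'M[B]_(rk G i, rk F i),
    [/\ forall i, mx_homog (deg G i) (deg F i) (f i),
        forall v, augG (f 0%N *m v) = augF v
      & forall i, diff G i *m f i.+1 = f i *m diff F i].
Proof.
move=> resF resG.
have [_ augF_h _ exF0 exF] := resF; have [_ augG_h augG_s exG0 exG] := resG.
have /choice[g gP] (j : 'I_(rk F 0)) : exists u : 'cV[B]_(rk G 0),
    (forall l, BK_homog (deg F 0%N j - deg G 0%N l) (u l 0)) /\
    augG u = augF (delta_mx j 0).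
  have uF_h := augF_h _ _ (free_homog_delta j).
  have [u uE] := augG_s (augF (delta_mx j 0)).
  exists (vcomp (deg G 0%N) (deg F 0%N j) u); split.
    by move=> l; apply: vcomp_homog.
  exact: (aug_vcomp augG_h uF_h uE).
pose f0 : 'M[B]_(rk G 0, rk F 0) := \matrix_(l, j) g j l 0.
have f0_aug v : augG (f0 *m v) = augF v.
  rewrite aug_mulmx -[v in RHS]mul1mx aug_mulmx; apply: eq_bigr => j _.
  congr (_ *: _); have -> : col j f0 = g j.
    by apply/matrixP => l i; rewrite ord1 !mxE.
  by rewrite (gP j).2 colE mul1mx.
pose P i (f : 'M[B]_(rk G i, rk F i)) := mx_homog (deg G i) (deg F i) f /\
  forall w : 'cV[B]_(rk F i.+1),
    exists u : 'cV[B]_(rk G i.+1), f *m (diff F i *m w) = diff G i *m u.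
pose R i (f : 'M[B]_(rk G i, rk F i)) (f' : 'M[B]_(rk G i.+1, rk F i.+1)) :=
  diff G i *m f' = f *m diff F i.
have P0 : P 0%N f0.
  split=> [l j|w]; first by rewrite mxE; apply: (gP j).1.
  by apply/exG0; rewrite f0_aug; apply/exF0; exists w.
have step i f : P i f -> exists2 f', P i.+1 f' & R i f f'.
  case=> f_h f_im.
  have [|w|f' f'_h f'E] := lift_mx (diff_homog resG i)
      (f := f *m diff F i) (dc := deg F i.+1) (D := diff G i).
  - exact: mx_homogM f_h (diff_homog resF i).
  - by rewrite -mulmxA; apply: f_im.
  exists f' => //; split=> // w; apply/exG.
  by rewrite mulmxA f'E -mulmxA (mulmxA (diff F i)) (diff_diff resF i) mul0mx mulmx0.
have [f [f0E fP fR]] := dependent_sequence P0 step.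
exists f; split; [by move=> i; exact: (fP i).1 | | exact: fR].
by move=> v; rewrite f0E.
Qed.

(** The same lifting as for chain maps. The invariant is that phi i - d h vanishes on boundaries, which makes the next difference
    phi - h d take its values in cycles. *)
Lemma null_homotopy F M (aug : augmentation F M)
    (phi : forall i, 'M[B]_(rk F i)) : graded_free_resolution aug ->
  (forall i, mx_homog (deg F i) (deg F i) (phi i)) ->
  (forall v, aug (phi 0%N *m v) = 0) ->
  (forall i, diff F i *m phi i.+1 = phi i *m diff F i) ->
  exists h : forall i, 'M[B]_(rk F i.+1, rk F i),
    [/\ forall i, mx_homog (deg F i.+1) (deg F i) (h i),
        phi 0%N = diff F 0 *m h 0%N
      & forall i, phi i.+1 = diff F i.+1 *m h i.+1 + h i *m diff F i].
Proof.
move=> res phi_h phi_aug phi_chain; have [_ _ _ ex0 ex] := res.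
have [|h0 h0_h h0E] := lift_mx (diff_homog res 0) (phi_h 0%N).
  by move=> w; apply/ex0; apply: phi_aug.
pose P i (h : 'M[B]_(rk F i.+1, rk F i)) := mx_homog (deg F i.+1) (deg F i) h /\
  (phi i - diff F i *m h) *m diff F i = 0.
pose R i (h : 'M[B]_(rk F i.+1, rk F i)) (h' : 'M[B]_(rk F i.+2, rk F i.+1)) :=
  phi i.+1 = diff F i.+1 *m h' + h *m diff F i.
have P0 : P 0%N h0 by split=> //; rewrite h0E subrr mul0mx.
have step i h : P i h -> exists2 h', P i.+1 h' & R i h h'.
  case=> h_h hD.
  have [|w|h' h'_h h'E] := lift_mx (diff_homog res i.+1)
      (f := phi i.+1 - h *m diff F i) (dc := deg F i.+1).
  - apply: mx_homogB => //; exact: mx_homogM h_h (diff_homog res i).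
  - apply/ex; rewrite mulmxA mulmxBr phi_chain mulmxA -mulmxBl.
    by rewrite hD mul0mx.
  exists h'; last by rewrite /R h'E subrK.
  split=> //; rewrite h'E opprB addrC subrK.
  by rewrite -mulmxA (diff_diff res i) mulmx0.
have [h [h0E' hP hR]] := dependent_sequence P0 step.
exists h; split; [by move=> i; exact: (hP i).1 | | exact: hR].
by rewrite h0E'.
Qed.

Lemma tensor_partP F i j (v : 'cV[k]_(rk F i)) :
  reflect (forall l, gen_deg l != j -> v l 0 = 0) (v \in tensor_part F i j).
Proof.
apply: (iffP idP) => [v_in l l_j|v0].
  have sub : (tensor_part F i j <=
      lker (linfun (fun u : 'cV[k]_(rk F i) => row l u)))%VS.
    apply/span_subvP => _ /mapP[l' + ->]; rewrite mem_filter => /andP[/eqP l'_j _].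
    rewrite memv_ker lfunE /=; apply/eqP/matrixP => a b; rewrite !mxE.
    by case: eqP => // ll'; rewrite ll' l'_j eqxx in l_j.
  have := subvP sub _ v_in; rewrite memv_ker lfunE /= => /eqP/matrixP/(_ 0 0).
  by rewrite !mxE.
rewrite (matrix_sum_delta v); apply: memv_suml => l _; rewrite big_ord1.
have [l_j|/v0 ->] := eqVneq (gen_deg l) j; last by rewrite scale0r mem0v.
apply: memvZ; apply: memv_span; apply/mapP; exists l => //.
by rewrite mem_filter l_j eqxx mem_enum.
Qed.

Lemma tensor_part_mulmx F G i i' j (f : 'M[B]_(rk G i', rk F i)) v :
  mx_homog (deg G i') (deg F i) f -> v \in tensor_part F i j ->
  map_mx (@BK_aug k alpha) f *m v \in tensor_part G i' j.
Proof.
move=> f_h /tensor_partP v0; apply/tensor_partP => l l_j; rewrite mxE big1 // => m _.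
rewrite mxE; have [m_j|/v0 ->] := eqVneq (gen_deg m) j; last by rewrite mulr0.
by rewrite (BK_aug_homog (f_h l m)) ?mul0r // m_j subr_eq0 eq_sym.
Qed.

Lemma tensor_boundariesP F i j (v : 'cV[k]_(rk F i)) :
  reflect (exists2 w, w \in tensor_part F i.+1 j & v = tensor_diff F i *m w)
    (v \in tensor_boundaries F i j).
Proof.
apply: (iffP memv_imgP) => [[w w_j ->]|[w w_j ->]]; exists w => //;
  by rewrite lfunE.
Qed.

(** Position 0 carries no condition, so the definition follows the position. *)
Definition tensor_cycle F i (v : 'cV[k]_(rk F i)) : Prop :=
  match i return 'cV[k]_(rk F i) -> Prop with
  | 0 => fun _ => True
  | i'.+1 => fun v => tensor_diff F i' *m v = 0
  end v.

Lemma tensor_cyclesP F i j (v : 'cV[k]_(rk F i)) :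
  v \in tensor_cycles F i j <-> v \in tensor_part F i j /\ tensor_cycle v.
Proof.
case: i v => [|i] v; first by split=> [|[]].
rewrite /= memv_cap memv_ker lfunE /=.
by split=> [/andP[-> /eqP]|[-> ->]]; rewrite ?eqxx.
Qed.

(** Chain maps in both directions compose to a map homotopic to the identity; so
    after reduction by the augmentation the map from F to G is injective in
    homology. Exchanging F and G gives equality. *)
Lemma tensor_homology_dim_le F G M (augF : augmentation F M)
    (augG : augmentation G M) i j :
  graded_free_resolution augF -> graded_free_resolution augG ->
  (tensor_homology_dim F i j <= tensor_homology_dim G i j)%N.
Proof.
move=> resF resG.
have [f [f_h f_aug f_chain]] := chain_map resF resG.
have [g [g_h g_aug g_chain]] := chain_map resG resF.
have [||i'|h [h_h h0 hS]] :=
  null_homotopy (phi := fun i => g i *m f i - 1%:M) resF.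
- move=> i'; apply: mx_homogB; last exact: mx_homog1.
  exact: mx_homogM (g_h _) (f_h _).
- move=> v; rewrite mulmxBl mul1mx linearB /= -mulmxA g_aug f_aug subrr //.
- rewrite mulmxBr mulmxBl mulmxA g_chain -!mulmxA f_chain mul1mx mulmx1.
  by [].
pose red m n (D : 'M[B]_(m, n)) := map_mx (@BK_aug k alpha) D.
have redM m n p (D : 'M[B]_(m, n)) (E : 'M[B]_(n, p)) :
    red _ _ (D *m E) = red _ _ D *m red _ _ E.
  exact: map_mxM.
have f_cyc v : tensor_cycle v -> tensor_cycle (red _ _ (f i) *m v).
  case: i v => [//|i'] v /= v0.
  by rewrite mulmxA /tensor_diff -map_mxM f_chain map_mxM -mulmxA v0 mulmx0.
have gf_homotopy v : v \in tensor_part F i j -> tensor_cycle v ->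
    red _ _ (g i) *m (red _ _ (f i) *m v) - v \in tensor_boundaries F i j.
  move=> v_j v_cyc.
  have -> : red _ _ (g i) *m (red _ _ (f i) *m v) - v =
      red _ _ (g i *m f i - 1%:M) *m v.
    by rewrite /red map_mxB map_mx1 mulmxBl mul1mx map_mxM mulmxA.
  case: i v v_j v_cyc {f_cyc} => [|i'] v v_j v_cyc.
    rewrite h0 redM -mulmxA; apply/tensor_boundariesP.
    by exists (red _ _ (h 0%N) *m v); first exact: tensor_part_mulmx v_j.
  rewrite hS /red map_mxD !map_mxM mulmxDl -!mulmxA v_cyc mulmx0 addr0.
  apply/tensor_boundariesP.
  by exists (red _ _ (h i'.+1) *m v); first exact: tensor_part_mulmx v_j.
apply: (dim_quotient_le (L := linfun (mulmx (red _ _ (f i))))).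
- apply/subvP => _ /memv_imgP[v /tensor_cyclesP[v_j v_cyc] ->].
  rewrite lfunE /=; apply/tensor_cyclesP; split; last exact: f_cyc.
  exact: tensor_part_mulmx.
- apply/subvP => _ /tensor_boundariesP[w w_j ->]; apply/tensor_cyclesP; split.
    exact: tensor_part_mulmx (diff_homog resG i) w_j.
  case: i {f_cyc gf_homotopy} w w_j => [//|i'] w _ /=.
  by rewrite mulmxA /tensor_diff -map_mxM (diff_diff resG) map_mx0 mul0mx.
move=> v /tensor_cyclesP[v_j v_cyc]; rewrite lfunE /= => /tensor_boundariesP[w w_j fv].
have := gf_homotopy v v_j v_cyc; rewrite fv => gv.
rewrite -[v](subKr (red _ _ (g i) *m (tensor_diff G i *m w))); apply: memvB => //.
apply/tensor_boundariesP; exists (red _ _ (g i.+1) *m w).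
  exact: tensor_part_mulmx w_j.
by rewrite !mulmxA /tensor_diff -!map_mxM g_chain.
Qed.

End TensorComparison.

(** * The resolution of the trivial module *)

Section Entries.
Variables (k : fieldType) (alpha : k) (A : algType k) (x1 x2 y1 y2 : A).
Variable P : A -> Prop.
Hypotheses (P0 : P 0) (Px1 : P x1) (Px2 : P x2) (Py1 : P y1) (Py2 : P y2)
  (PN : forall a, P a -> P (- a)) (PZ : forall c a, P a -> P (c *: a)).

Fixpoint all_entries (s : seq A) : Prop :=
  if s is a :: s' then P a /\ all_entries s' else True.

Lemma rows_mx_entries m n rows : all_entries (flatten rows) ->
  forall i j, P (rows_mx (A := A) m n rows i j).
Proof.
move=> Pr i j; rewrite mxE; elim: rows (nat_of_ord i) Pr => [|r rows IHr] [|l] //=.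
- by rewrite nth_nil.
- by rewrite nth_nil.
- elim: r (nat_of_ord j) => [|a r IH] [|l] //= [] // Pa; exact: IH.
- move=> Pr; apply: IHr; elim: r Pr => //= a r IH [_]; exact: IH.
Qed.

(** All entries are signed scalar multiples of generators, or 0. Used with P being
    homogeneous of degree 1, and with P having augmentation 0. *)
Lemma koszul_entries : [/\
  forall i j, P (rows_mx 1 4 (rows1 x1 x2 y1 y2) i j),
  forall i j, P (rows_mx 4 6 (rows2 alpha x1 x2 y1 y2) i j),
  forall i j, P (rows_mx 6 4 (rows3 alpha x1 x2 y1 y2) i j)
 & forall i j, P (rows_mx 4 1 (rows4 alpha x1 x2 y1 y2) i j)].
Proof.
by split; apply: rows_mx_entries; do !split=> //=; do ?apply: PN; auto.
Qed.
End Entries.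

Lemma empty_col_eq (R : Type) n (u v : 'cV[R]_n) : n = 0%N -> u = v.
Proof. by move=> n0; apply/matrixP => i; exfalso; move: i; rewrite n0 => -[]. Qed.

Lemma col_sum_delta (A : nzRingType) n (w : 'cV[A]_n) :
  w = \sum_l (delta_mx l 0 : 'cV_n) *m (w l 0)%:M.
Proof.
apply/matrixP => a b; rewrite ord1 summxE.
have E l : ((delta_mx l 0 : 'cV_n) *m (w l 0)%:M) a 0 = (a == l)%:R * w l 0.
  by rewrite mxE big_ord1 mxE [_%:M _ _]mxE eqxx andbT mulr1n.
rewrite (bigD1 a) //= E eqxx mul1r big1 ?addr0 // => l l_a.
by rewrite E eq_sym (negPf l_a) mul0r.
Qed.

Section KoszulResolution.
Variables (k : fieldType) (alpha : k).
Local Notation B := (BK alpha).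
Local Notation x1 := (BKx1 alpha).
Local Notation x2 := (BKx2 alpha).
Local Notation y1 := (BKy1 alpha).
Local Notation y2 := (BKy2 alpha).

Lemma BK_diff_entries (P : B -> Prop) :
  P 0 -> P x1 -> P x2 -> P y1 -> P y2 -> (forall a, P a -> P (- a)) ->
  (forall c a, P a -> P (c *: a)) ->
  forall i l j, P (BK_diff alpha i l j).
Proof.
move=> P0 Px1 Px2 Py1 Py2 PN PZ.
have [d1 d2 d3 d4] := koszul_entries alpha P0 Px1 Px2 Py1 Py2 PN PZ.
case=> [|[|[|[|i]]]] l j; [exact: d1 | exact: d2 | exact: d3 | exact: d4 | ].
by rewrite mxE.
Qed.

Lemma BK_diff_homog i : mx_homog (fun=> i%:Z) (fun=> i.+1%:Z) (BK_diff alpha i).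
Proof.
move=> l j; have -> : i.+1%:Z - i%:Z = 1 by rewrite -addn1 PoszD addrC addKr.
apply: (BK_diff_entries (P := fun b => BK_homog 1 b)).
- exact: BK_homog0.
- exact: BK_homog_letter.
- exact: BK_homog_letter.
- exact: BK_homog_letter.
- exact: BK_homog_letter.
- exact: BK_homogN.
- move=> c a; exact: BK_homogZ.
Qed.

Lemma BK_diff_aug i l j : BK_aug (BK_diff alpha i l j) = 0.
Proof.
apply: (BK_diff_entries (P := fun b => BK_aug b = 0)).
- exact: rmorph0.
- exact: BK_aug_x1.
- exact: BK_aug_x2.
- exact: BK_aug_y1.
- exact: BK_aug_y2.
- by move=> a a0; apply: etrans (rmorphN (@BK_aug k alpha) a) _; rewrite /= a0 oppr0.
- move=> c a a0; have -> : c *: a = (c *: 1) * a by rewrite -scalerAl mul1r.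
  by apply: etrans (rmorphM (@BK_aug k alpha) _ _) _; rewrite /= a0 mulr0.
Qed.

Lemma BK_exact0 (v : 'cV[B]_1) : BK_aug (v 0 0) = 0 <->
  exists w : 'cV[B]_4, v = BK_diff alpha 0 *m w.
Proof.
split=> [v0|[w ->]]; last first.
  rewrite mxE rmorph_sum big1 // => j _.
  apply: etrans (rmorphM (@BK_aug k alpha) _ _) _.
  by rewrite /= (@BK_diff_aug 0%N) mul0r.
have [s s4 vE] := BK_aug_gens v0; exists (seq_col 4 s).
have -> : BK_diff alpha 0 = rows_mx 1 4 (rows1 x1 x2 y1 y2) by [].
rewrite mul_rows_mx //; apply/matrixP => i j.
by rewrite !ord1 mxE vE.
Qed.

Lemma BK_exact i (v : 'cV[B]_(BK_rk i.+1)) : BK_diff alpha i *m v = 0 <->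
  exists w : 'cV[B]_(BK_rk i.+2), v = BK_diff alpha i.+1 *m w.
Proof.
have r1 := BK_x2x1 alpha; have r2 := BK_y2y1 alpha; have r3 := BK_y1x1 alpha.
have r4 := BK_y1x2 alpha; have r5 := BK_y2x1 alpha; have r6 := BK_y2x2 alpha.
have reg1 := @BK_x1_reg k alpha; have reg2 := @BK_x2_reg k alpha.
have syz := @BK_x_syz k alpha.
case: i v => [|[|[|[|i]]]] v.
- exact: (exact12 r1 r2 r3 r4 r5 r6 syz (@BK_y_syz k alpha)).
- exact: (exact23 r1 r2 r3 r4 r5 r6 reg2 syz (@BK_y1_reg k alpha)).
- exact: (exact34 r1 r2 r3 r4 r5 r6 reg2 syz).
- split=> [|[w ->]]; last by rewrite [_ *m w]mul0mx mulmx0.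
  by move/(exact4 reg1) => ->; exists 0; rewrite mulmx0.
- split=> _; last exact: mul0mx.
  exists 0; apply: empty_col_eq.
  exact: (@nth_default _ 0%N [:: 1; 4; 6; 4; 1]%N i.+4.+1).
Qed.

Lemma BK_seq_resolution :
  @graded_free_resolution k alpha (BK_sequence alpha) (kB alpha)
    (@BK_seq_aug k alpha).
Proof.
split.
- move=> i d v v_h l; rewrite mxE; apply: BK_homog_sum => j _.
  have -> : d - @gen_deg k alpha (BK_sequence alpha) i l =
      (i.+1%:Z - i%:Z) + (d - i.+1%:Z).
    by rewrite [RHS]addrC subrKA.
  exact: BK_homogM (BK_diff_homog l j) (v_h j).
- move=> d v v_h; have [->|d0] := eqVneq d 0; [by left | right].
  by apply: BK_aug_homog (v_h 0) _; rewrite subr0.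
- move=> u; exists (const_mx ((u : k) *: (1 : B))); rewrite /= /BK_seq_aug mxE.
  rewrite -[1]/(toBK alpha 1) -toBKZ BK_aug_toBK mcoeffZ mcoeff1 eqxx.
  exact: mulr1.
- exact: BK_exact0.
- exact: BK_exact.
Qed.

Lemma BK_seq_minimal i (v : 'cV[B]_(BK_rk i.+1)) :
  @in_FB_ge1 k alpha (BK_sequence alpha) i (BK_diff alpha i *m v).
Proof.
set w := _ *m v; exists (BK_rk i), (fun l => delta_mx l 0), (fun l => w l 0).
split=> [l|].
  apply/BK_aug_eq0; rewrite mxE rmorph_sum big1 // => j _.
  by apply: etrans (rmorphM (@BK_aug k alpha) _ _) _; rewrite /= BK_diff_aug mul0r.
exact: col_sum_delta.
Qed.

(** All reduced differentials vanish and all generators in position i have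
    degree i, so the homology is the whole space. *)
Lemma BK_tensor_homology i :
  tensor_homology_dim (BK_sequence alpha) i i%:Z = BK_rk i.
Proof.
have diff0' j : tensor_diff (BK_sequence alpha) j = 0.
  by apply/matrixP => l m; rewrite !mxE; apply: BK_diff_aug.
rewrite /tensor_homology_dim.
have -> : tensor_cycles (BK_sequence alpha) i i%:Z = fullv.
  apply/vspaceP => v; rewrite memvf; apply/tensor_cyclesP; split.
    by apply/tensor_partP => l; rewrite eqxx.
  by case: i v => [//|i] v /=; rewrite diff0' mul0mx.
have -> : tensor_boundaries (BK_sequence alpha) i i%:Z = 0%VS.
  apply/eqP; rewrite -subv0; apply/subvP => v /tensor_boundariesP[w _ ->].
  by rewrite diff0' mul0mx mem0v.
by rewrite dimv0 subn0 dimvf /dim /= muln1.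
Qed.

(** Two resolutions bound each other's homology, so the one picked by the
    definition of the Betti numbers does not matter. *)
Lemma betti_resolution F M (aug : augmentation F M) i j :
  graded_free_resolution aug -> betti M i j = @tensor_homology_dim k alpha F i j.
Proof.
move=> res; rewrite /betti; case: pselect => [ex|]; last first.
  by case; exists F, aug.
have [aug' res'] := svalP (cid ex).
by apply/eqP; rewrite eqn_leq; apply/andP; split;
  [exact: tensor_homology_dim_le res' res | exact: tensor_homology_dim_le res res'].
Qed.

End KoszulResolution.

Theorem theorem4p1 (k : fieldType) (alpha : k) (alpha_neq0 : alpha != 0) :
  @minimal_graded_free_resolution k alpha (BK_sequence alpha) (kB alpha)
    (@BK_seq_aug k alpha) /\
  [/\ betti (kB alpha) 0 0 = 1%N, betti (kB alpha) 1 1 = 4%N,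
      betti (kB alpha) 2 2 = 6%N, betti (kB alpha) 3 3 = 4%N
    & betti (kB alpha) 4 4 = 1%N].
Proof.
have res := BK_seq_resolution alpha.
have bettiE i : betti (kB alpha) i i%:Z = BK_rk i.
  by rewrite (betti_resolution _ _ res) BK_tensor_homology.
split; first by split=> // i v; apply: BK_seq_minimal.
by split; rewrite bettiE.
Qed.
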